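(* Let $n\ge3$ and let $F_n$ be the $A$-algebra defined in the context. (1) The $S^{\dagger\dagger}$-algebra $F_n\otimes_A S^{\dagger\dagger}$ is a quotient of $H_n\otimes_R S^{\dagger\dagger}$ through $s_i\mapsto s_i$, where $A\to S^{\dagger\dagger}$ is given by $a\mapsto a$, $x\mapsto b+c$. This quotient map factorizes through $BMW_n^{\dagger\dagger}=\widetilde{BMW}_n\otimes_R S^{\dagger\dagger}$. (2) There is a surjective morphism of $S^{\dagger\dagger}_{\pm}$-algebras $F_n\otimes_A S^{\dagger\dagger}_{\pm}\to BMW_n^{\pm}\otimes_{S_{\pm}}S^{\dagger\dagger}_{\pm}$ satisfying $s_i\mapsto s_i$, $e_i\mapsto e_i$, $C\mapsto0$. Its kernel is the linear span of $C$. (3) The automorphism and the antiautomorphism of the $A$-algebra $AB_n$ defined by $s_i\mapsto s_i^{-1}$ induce an automorphism and an antiautomorphism of $F_n$, respectively. (4) Every Markov trace $(t_m)_{m\ge1}$, with values in an $A$-module, factorizing through the $F_m$ is uniquely determined by $t_3(1)$, $t_3(s_1)$ and $t_3(s_1s_2)$.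
   Context: $A=\mathbb{Q}[a,x,x^{-1}]/(a^2-1)$. For $n\ge3$, $F_n$ is the unital $A$-algebra with generators $s_1,\dots,s_{n-1}$ (invertible by the cubic relation), $e_1,\dots,e_{n-1}$, $C$ and relations (for all meaningful indices): $s_is_{i+1}s_i=s_{i+1}s_is_{i+1}$; $s_is_j=s_js_i$ for $|i-j|\ge2$; $(s_i-a)(s_i^2-xs_i+1)=0$; $e_i=a\left(\frac{s_i^{-1}+s_i}{x}-1\right)$; $s_ie_i=ae_i$; $e_is_{i\pm1}e_i=e_i+C$; $e_is_{i\pm1}^{-1}e_i=e_i+C$; $s_iC=Cs_i=aC$. $R=\mathbb{Q}[a,b,c,(abc)^{-1}]$, $x=b+c$, $y=bc$, $S=R[x^{-1}]$, $S_\pm=S/(a\mp y)$, $S^{\dagger\dagger}=S/(a^2-1,y-1)$, $S^{\dagger\dagger}_{\pm}=S^{\dagger\dagger}/(a\mp1)$. $B_n$ is the braid group with Artin generators $s_i$; $H_n=RB_n/((s_i-a)(s_i-b)(s_i-c))$. $\widetilde{BMW}_n$ is the quotient of $H_n$ by the two-sided ideal generated by $$\mathcal{R}_i=-y\,s_is_{i+1}^{-1}s_i+y^2s_{i+1}^{-1}s_is_{i+1}^{-1}-s_is_{i+1}s_i-xy^2s_{i+1}^{-2}+x\,s_i^2+y^3s_{i+1}^{-1}s_i^{-1}s_{i+1}^{-1},\quad 1\le i\le n-2.$$ $BMW_n^{\pm}$ is the quotient of $H_n\otimes_R S_{\pm}$ by the two-sided ideal generated by $e_1s_2e_1-e_1$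 and $e_1s_2^{-1}e_1-e_1$, where $e_i=\frac{as_i^{-1}\pm s_i}{x}\mp1$. A Markov trace $(t_m)_{m\ge1}$ with values in an $A$-module $M$ is a sequence of $A$-linear maps $t_m:AB_m\to M$ with $t_m(uv)=t_m(vu)$ and $t_{m+1}(us_m^{\pm1})=t_m(u)$ for all $u,v\in AB_m$; it factorizes through the $F_m$ if $t_m$ factors through $AB_m\to F_m$ for every $m\ge3$. *)

(* Defs.v *)
From HB Require Import structures.
From mathcomp Require Import all_boot all_order all_algebra.
From mathcomp Require Import boolp.

Set Implicit Arguments.
Unset Strict Implicit.
Unset Printing Implicit Defensive.

Import GRing.Theory.
Local Open Scope ring_scope.
Local Open Scope quotient_scope.

Reserved Notation "k %:S" (at level 1, left associativity, format "k %:S").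

(* Associative unital K-algebras, given by the central structure morphism      *)
(* K -> B.  The library's algType also requires 1 != 0, which cannot be known   *)
(* beforehand for a ring given by a presentation.                              *)
HB.mixin Record hasScalars (K : comPzRingType) B of GRing.PzRing B := {
  scalar : K -> B;
  scalar_is_zmod_morphism : zmod_morphism scalar;
  scalar_is_monoid_morphism : monoid_morphism scalar;
  scalarC : forall k u, scalar k * u = u * scalar k
}.

#[short(type="pzAlgType")]
HB.structure Definition PzAlgebra (K : comPzRingType) :=
  {B of GRing.PzRing B & hasScalars K B}.

Notation "k %:S" := (scalar k) : ring_scope.

HB.instance Definition _ (K : comPzRingType) (B : pzAlgType K) :=
  GRing.isZmodMorphism.Build K B (@scalar K B) scalar_is_zmod_morphism.
HB.instance Definition _ (K : comPzRingType) (B : pzAlgType K) :=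
  GRing.isMonoidMorphism.Build K B (@scalar K B) scalar_is_monoid_morphism.

Definition alg_morphism (K : comPzRingType) (B D : pzAlgType K) (f : B -> D) :=
  [/\ zmod_morphism f, monoid_morphism f & forall k : K, f k%:S = k%:S].

Definition alg_antimorphism (K : comPzRingType) (B D : pzAlgType K)
    (f : B -> D) :=
  [/\ zmod_morphism f, f 1 = 1, forall u v, f (u * v) = f v * f u
    & forall k : K, f k%:S = k%:S].

(* K-linear maps from a K-algebra to a K-module *)
Definition mod_linear (K : comPzRingType) (B : pzAlgType K) (M : lmodType K)
    (f : B -> M) :=
  zmod_morphism f /\ forall k u, f (k%:S * u) = k *: f u.

Definition surjective (T U : Type) (f : T -> U) := forall u, exists t, f t = u.

(* The free algebra K<X>: expressions modulo the axioms of a K-algebra.        *)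
Section Free.
Variables (K : comPzRingType) (X : Type).

Inductive fterm : Type :=
| Cst of K
| Gen of X
| Add of fterm & fterm
| Mul of fterm & fterm.

HB.instance Definition _ := gen_eqMixin fterm.
HB.instance Definition _ := gen_choiceMixin fterm.

Inductive feq : fterm -> fterm -> Prop :=
| feq_refl s : feq s s
| feq_sym s t : feq s t -> feq t s
| feq_trans s t u : feq s t -> feq t u -> feq s u
| feq_add s s' t t' : feq s s' -> feq t t' -> feq (Add s t) (Add s' t')
| feq_mul s s' t t' : feq s s' -> feq t t' -> feq (Mul s t) (Mul s' t')
| feq_addA s t u : feq (Add s (Add t u)) (Add (Add s t) u)
| feq_addC s t : feq (Add s t) (Add t s)
| feq_add0 s : feq (Add (Cst 0) s) s
| feq_mul0 s : feq (Mul (Cst 0) s) (Cst 0)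
| feq_mulA s t u : feq (Mul s (Mul t u)) (Mul (Mul s t) u)
| feq_mul1l s : feq (Mul (Cst 1) s) s
| feq_mul1r s : feq (Mul s (Cst 1)) s
| feq_mulDl s t u : feq (Mul (Add s t) u) (Add (Mul s u) (Mul t u))
| feq_mulDr s t u : feq (Mul s (Add t u)) (Add (Mul s t) (Mul s u))
| feq_cstD k l : feq (Cst (k + l)) (Add (Cst k) (Cst l))
| feq_cstM k l : feq (Cst (k * l)) (Mul (Cst k) (Cst l))
| feq_cstC k s : feq (Mul (Cst k) s) (Mul s (Cst k)).

Definition feqb : rel fterm := fun s t => `[< feq s t >].

Lemma feqb_refl : reflexive feqb.
Proof. by move=> s; apply/asboolP; apply: feq_refl. Qed.
Lemma feqb_sym : symmetric feqb.
Proof. by move=> s t; apply: asbool_equiv_eq; split; apply: feq_sym. Qed.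
Lemma feqb_trans : transitive feqb.
Proof.
by move=> t s u /asboolP st /asboolP tu; apply/asboolP; apply: feq_trans st tu.
Qed.

Canonical feq_equiv := EquivRel feqb feqb_refl feqb_sym feqb_trans.

Definition free := {eq_quot feq_equiv}.
HB.instance Definition _ := Choice.on free.
HB.instance Definition _ := Quotient.on free.

Lemma free_piE s t : \pi_free s = \pi_free t <-> feq s t.
Proof. by split=> [/eqmodP/asboolP|st] //; apply/eqmodP/asboolP. Qed.

Lemma feq_repr s : feq (repr (\pi_free s)) s.
Proof. by apply/free_piE; rewrite reprK. Qed.

Definition fcst (k : K) : free := \pi_free (Cst k).
Definition fgen (x : X) : free := \pi_free (Gen x).
Definition fadd (u v : free) : free := \pi_free (Add (repr u) (repr v)).
Definition fmul (u v : free) : free := \pi_free (Mul (repr u) (repr v)).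
Definition fopp (u : free) : free := \pi_free (Mul (Cst (-1)) (repr u)).

Lemma pi_fadd s t : fadd (\pi_free s) (\pi_free t) = \pi_free (Add s t).
Proof. by apply/free_piE; apply: feq_add; apply: feq_repr. Qed.
Lemma pi_fmul s t : fmul (\pi_free s) (\pi_free t) = \pi_free (Mul s t).
Proof. by apply/free_piE; apply: feq_mul; apply: feq_repr. Qed.

Let piP (u : free) : exists s, u = \pi_free s.
Proof. by exists (repr u); rewrite reprK. Qed.

Fact faddA : associative fadd.
Proof.
move=> u v w; have [[[s ->] [t ->]] [r ->]] := (piP u, piP v, piP w).
by rewrite !pi_fadd; apply/free_piE; apply: feq_addA.
Qed.
Fact faddC : commutative fadd.
Proof.
move=> u v; have [[s ->] [t ->]] := (piP u, piP v).
by rewrite !pi_fadd; apply/free_piE; apply: feq_addC.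
Qed.
Fact fadd0 : left_id (fcst 0) fadd.
Proof.
by move=> u; have [s ->] := piP u; rewrite pi_fadd; apply/free_piE/feq_add0.
Qed.
Fact fmulA : associative fmul.
Proof.
move=> u v w; have [[[s ->] [t ->]] [r ->]] := (piP u, piP v, piP w).
by rewrite !pi_fmul; apply/free_piE; apply: feq_mulA.
Qed.
Fact fmul1l : left_id (fcst 1) fmul.
Proof.
by move=> u; have [s ->] := piP u; rewrite pi_fmul; apply/free_piE/feq_mul1l.
Qed.
Fact fmul1r : right_id (fcst 1) fmul.
Proof.
by move=> u; have [s ->] := piP u; rewrite pi_fmul; apply/free_piE/feq_mul1r.
Qed.
Fact fmulDl : left_distributive fmul fadd.
Proof.
move=> u v w; have [[[s ->] [t ->]] [r ->]] := (piP u, piP v, piP w).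
by rewrite !(pi_fmul, pi_fadd); apply/free_piE; apply: feq_mulDl.
Qed.
Fact fmulDr : right_distributive fmul fadd.
Proof.
move=> u v w; have [[[s ->] [t ->]] [r ->]] := (piP u, piP v, piP w).
by rewrite !(pi_fmul, pi_fadd); apply/free_piE; apply: feq_mulDr.
Qed.
Fact fcstD k l : fcst (k + l) = fadd (fcst k) (fcst l).
Proof. by rewrite pi_fadd; apply/free_piE/feq_cstD. Qed.
Fact fcstM k l : fcst (k * l) = fmul (fcst k) (fcst l).
Proof. by rewrite pi_fmul; apply/free_piE/feq_cstM. Qed.
Fact fcstC k u : fmul (fcst k) u = fmul u (fcst k).
Proof.
by have [s ->] := piP u; rewrite !pi_fmul; apply/free_piE/feq_cstC.
Qed.
Lemma foppE u : fopp u = fmul (fcst (-1)) u.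
Proof.
by have [s ->] := piP u; rewrite pi_fmul; apply/free_piE/feq_mul/feq_repr/feq_refl.
Qed.
Fact faddN : left_inverse (fcst 0) fopp fadd.
Proof.
move=> u; rewrite foppE -[X in fadd _ X]fmul1l -fmulDl -fcstD addNr.
by have [s ->] := piP u; rewrite pi_fmul; apply/free_piE/feq_mul0.
Qed.

HB.instance Definition _ := GRing.isZmodule.Build free faddA faddC fadd0 faddN.
HB.instance Definition _ :=
  GRing.Zmodule_isPzRing.Build free fmulA fmul1l fmul1r fmulDl fmulDr.

Fact fcst_is_zmod_morphism : zmod_morphism (fcst : K -> free).
Proof.
move=> k l; rewrite fcstD; congr fadd.
by rewrite [RHS]foppE -[- l]mulN1r fcstM.
Qed.
Fact fcst_is_monoid_morphism : monoid_morphism (fcst : K -> free).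
Proof. by split=> // k l; apply: fcstM. Qed.

HB.instance Definition _ := hasScalars.Build K free
  fcst_is_zmod_morphism fcst_is_monoid_morphism fcstC.

Lemma free_ind (Q : free -> Prop) :
    (forall k : K, Q k%:S) -> (forall x, Q (fgen x)) ->
    (forall u v, Q u -> Q v -> Q (u + v)) ->
    (forall u v, Q u -> Q v -> Q (u * v)) ->
  forall u, Q u.
Proof.
move=> Qk Qx QD QM u; have [s ->] := piP u.
elim: s => [k|x|s Qs t Qt|s Qs t Qt].
- exact: Qk.
- exact: Qx.
- by rewrite -pi_fadd; apply: QD.
- by rewrite -pi_fmul; apply: QM.
Qed.

End Free.

Arguments fgen {K X} x.

Section FreeLift.
Variables (K : comPzRingType) (X : Type) (D : pzRingType).
Variables (phi : K -> D) (g : X -> D).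

Fixpoint feval (s : fterm K X) : D :=
  match s with
  | Cst k => phi k
  | Gen x => g x
  | Add s t => feval s + feval t
  | Mul s t => feval s * feval t
  end.

(* The ring morphism K<X> -> D extending phi and g. *)
Definition free_lift (u : free K X) : D := feval (repr u).

Hypotheses (phiB : zmod_morphism phi) (phiM : monoid_morphism phi).
Hypothesis phiC : forall k d, phi k * d = d * phi k.

Lemma feval_eq s t : feq s t -> feval s = feval t.
Proof.
have phi0 : phi 0 = 0 by rewrite -(subrr 0) phiB subrr.
have phiD k l : phi (k + l) = phi k + phi l.
  by rewrite -{1}[l]opprK phiB -[- l]sub0r phiB phi0 sub0r opprK.
elim=> //= *; rewrite ?phi0 ?phiM.1 ?phiD ?phiM.2.
all: rewrite ?add0r ?mul0r ?mul1r ?mulr1 ?mulrDl ?mulrDr ?addrA ?mulrA //.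
all: try congruence.
by rewrite addrC.
Qed.

Lemma free_lift_pi s : free_lift (\pi_(free K X) s) = feval s.
Proof. by apply: feval_eq; apply: feq_repr. Qed.

Lemma free_lift_scalar k : free_lift k%:S = phi k.
Proof. exact: free_lift_pi. Qed.

Lemma free_lift_gen x : free_lift (fgen x) = g x.
Proof. exact: free_lift_pi. Qed.

Lemma free_liftM : monoid_morphism free_lift.
Proof.
split=> [|u v]; first by rewrite -phiM.1; apply: free_lift_pi.
by rewrite -[u]reprK -[v]reprK [_ * _]pi_fmul !free_lift_pi.
Qed.

Lemma free_liftB : zmod_morphism free_lift.
Proof.
have liftD u v : free_lift (u + v) = free_lift u + free_lift v.
  by rewrite -[u]reprK -[v]reprK [_ + _]pi_fadd !free_lift_pi.
move=> u v; rewrite liftD; congr (_ + _).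
apply: (addIr (free_lift v)); rewrite -liftD !addNr.
rewrite -(raddf0 (@scalar K (free K X))) free_lift_scalar.
by rewrite -[X in phi X](subrr 0) phiB subrr.
Qed.

End FreeLift.

(* The quotient of a ring by the two-sided ideal generated by P.               *)
Section Quot.
Variables (B : pzRingType) (P : B -> Prop).

Inductive ideal_gen : B -> Prop :=
| ideal_in p : P p -> ideal_gen p
| ideal_0 : ideal_gen 0
| ideal_D u v : ideal_gen u -> ideal_gen v -> ideal_gen (u + v)
| ideal_Ml w u : ideal_gen u -> ideal_gen (w * u)
| ideal_Mr w u : ideal_gen u -> ideal_gen (u * w).

Lemma ideal_N u : ideal_gen u -> ideal_gen (- u).
Proof. by rewrite -mulN1r; apply: ideal_Ml. Qed.

Definition ideal_eqb : rel B := fun u v => `[< ideal_gen (u - v) >].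

Lemma ideal_eqb_refl : reflexive ideal_eqb.
Proof. by move=> u; apply/asboolP; rewrite subrr; apply: ideal_0. Qed.
Lemma ideal_eqb_sym : symmetric ideal_eqb.
Proof.
by move=> u v; apply: asbool_equiv_eq; split=> /ideal_N; rewrite opprB.
Qed.
Lemma ideal_eqb_trans : transitive ideal_eqb.
Proof.
move=> v u w /asboolP uv /asboolP vw; apply/asboolP.
by rewrite -(subrK v u) -addrA; apply: ideal_D.
Qed.

Canonical ideal_equiv :=
  EquivRel ideal_eqb ideal_eqb_refl ideal_eqb_sym ideal_eqb_trans.

Definition quot := {eq_quot ideal_equiv}.
HB.instance Definition _ := Choice.on quot.
HB.instance Definition _ := Quotient.on quot.

Definition proj (u : B) : quot := \pi_quot u.

Lemma proj_eq u v : proj u = proj v <-> ideal_gen (u - v).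
Proof. by split=> [/eqmodP/asboolP|uv] //; apply/eqmodP/asboolP. Qed.

Lemma proj_surj : surjective proj.
Proof. by move=> z; exists (repr z); apply: reprK. Qed.

Lemma repr_proj u : ideal_gen (repr (proj u) - u).
Proof. by apply/proj_eq; apply: reprK. Qed.

Definition qadd (y z : quot) : quot := proj (repr y + repr z).
Definition qmul (y z : quot) : quot := proj (repr y * repr z).
Definition qopp (y : quot) : quot := proj (- repr y).

Lemma proj_add u v : qadd (proj u) (proj v) = proj (u + v).
Proof.
by apply/proj_eq; rewrite opprD addrACA; apply: ideal_D; apply: repr_proj.
Qed.
Lemma proj_mul u v : qmul (proj u) (proj v) = proj (u * v).
Proof.
apply/proj_eq; set u' := repr _; set v' := repr _.
have -> : u' * v' - u * v = (u' - u) * v' + u * (v' - v).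
  by rewrite mulrBl mulrBr addrA subrK.
by apply: ideal_D; [apply: ideal_Mr|apply: ideal_Ml]; apply: repr_proj.
Qed.
Lemma proj_opp u : qopp (proj u) = proj (- u).
Proof. by apply/proj_eq; rewrite -opprD; apply/ideal_N/repr_proj. Qed.

Ltac lift_proj :=
  repeat (let z := fresh "z" in move=> z; have [? <-] := proj_surj z; clear z);
  rewrite ?(proj_opp, proj_add, proj_mul).

Fact qaddA : associative qadd. Proof. by lift_proj; rewrite addrA. Qed.
Fact qaddC : commutative qadd. Proof. by lift_proj; rewrite addrC. Qed.
Fact qadd0 : left_id (proj 0) qadd. Proof. by lift_proj; rewrite add0r. Qed.
Fact qaddN : left_inverse (proj 0) qopp qadd.
Proof. by lift_proj; rewrite addNr. Qed.
Fact qmulA : associative qmul. Proof. by lift_proj; rewrite mulrA. Qed.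
Fact qmul1l : left_id (proj 1) qmul. Proof. by lift_proj; rewrite mul1r. Qed.
Fact qmul1r : right_id (proj 1) qmul. Proof. by lift_proj; rewrite mulr1. Qed.
Fact qmulDl : left_distributive qmul qadd.
Proof. by lift_proj; rewrite mulrDl. Qed.
Fact qmulDr : right_distributive qmul qadd.
Proof. by lift_proj; rewrite mulrDr. Qed.

HB.instance Definition _ := GRing.isZmodule.Build quot qaddA qaddC qadd0 qaddN.
HB.instance Definition _ :=
  GRing.Zmodule_isPzRing.Build quot qmulA qmul1l qmul1r qmulDl qmulDr.

Fact proj_is_zmod_morphism : zmod_morphism proj.
Proof. by move=> u v; rewrite -proj_add -proj_opp. Qed.
Fact proj_is_monoid_morphism : monoid_morphism proj.
Proof. by split=> // u v; rewrite -proj_mul. Qed.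

HB.instance Definition _ :=
  GRing.isZmodMorphism.Build B quot proj proj_is_zmod_morphism.
HB.instance Definition _ :=
  GRing.isMonoidMorphism.Build B quot proj proj_is_monoid_morphism.

Lemma proj_gen p : P p -> proj p = 0.
Proof. by move=> Pp; apply/proj_eq; rewrite subr0; apply: ideal_in. Qed.

Section Lift.
Variables (D : pzRingType) (f : B -> D).

(* The ring morphism quot B P -> D induced by f when f kills P.                *)
Definition quot_lift (z : quot) : D := f (repr z).

Hypotheses (fB : zmod_morphism f) (fM : monoid_morphism f).
Hypothesis fP : forall p, P p -> f p = 0.

Lemma quot_lift_proj u : quot_lift (proj u) = f u.
Proof.
have f0 : f 0 = 0 by rewrite -(subrr 0) fB subrr.
have fD v w : f (v + w) = f v + f w.
  by rewrite -{1}[w]opprK fB -[- w]sub0r fB f0 sub0r opprK.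
suff kill v : ideal_gen v -> f v = 0.
  by apply/eqP; rewrite -subr_eq0 -fB kill //; apply: repr_proj.
elim=> [p /fP|||w ? _ e|w ? _ e] //.
- by move=> ? ? _ e1 _ e2; rewrite fD e1 e2 addr0.
- by rewrite fM.2 e mulr0.
- by rewrite fM.2 e mul0r.
Qed.

Lemma quot_liftB : zmod_morphism quot_lift.
Proof.
move=> y z; have [[u <-] [v <-]] := (proj_surj y, proj_surj z).
by rewrite -rmorphB !quot_lift_proj fB.
Qed.

Lemma quot_liftM : monoid_morphism quot_lift.
Proof.
split=> [|y z]; first by rewrite -(rmorph1 proj) quot_lift_proj fM.1.
have [[u <-] [v <-]] := (proj_surj y, proj_surj z).
by rewrite -rmorphM !quot_lift_proj fM.2.
Qed.

End Lift.
End Quot.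

Arguments proj {B} P u.

Section QuotAlgebra.
Variables (K : comPzRingType) (B : pzAlgType K) (P : B -> Prop).

Definition quot_scalar (k : K) : quot P := proj P k%:S.

Fact quot_scalarB : zmod_morphism quot_scalar.
Proof. by move=> k l; rewrite /quot_scalar !rmorphB. Qed.
Fact quot_scalarM : monoid_morphism quot_scalar.
Proof.
by rewrite /quot_scalar; split=> [|k l]; rewrite ?rmorph1 // !rmorphM.
Qed.
Fact quot_scalarC k z : quot_scalar k * z = z * quot_scalar k.
Proof.
by have [u <-] := proj_surj z; rewrite /quot_scalar -!rmorphM scalarC.
Qed.

HB.instance Definition _ :=
  hasScalars.Build K (quot P) quot_scalarB quot_scalarM quot_scalarC.

Lemma proj_scalar (k : K) : proj P k%:S = k%:S.
Proof. by []. Qed.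

End QuotAlgebra.

Section QuotCommutative.
Variables (B : comPzRingType) (P : B -> Prop).

Fact quot_mulC : commutative (@GRing.mul (quot P)).
Proof.
move=> y z; have [[u <-] [v <-]] := (proj_surj y, proj_surj z).
by rewrite -!rmorphM mulrC.
Qed.

HB.instance Definition _ := GRing.PzRing_hasCommutativeMul.Build (quot P) quot_mulC.

End QuotCommutative.

Section Polynomials.
Variables (K : comPzRingType) (X : Type).

Inductive commutators : free K X -> Prop :=
| Commutator x x' : commutators (fgen x * fgen x' - fgen x' * fgen x).

Definition cpoly := quot commutators.
HB.instance Definition _ := PzAlgebra.on cpoly.

Definition cvar (x : X) : cpoly := proj commutators (fgen x).

Lemma cpoly_ind (Q : cpoly -> Prop) :
    (forall k : K, Q k%:S) -> (forall x, Q (cvar x)) ->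
    (forall u v, Q u -> Q v -> Q (u + v)) ->
    (forall u v, Q u -> Q v -> Q (u * v)) ->
  forall u, Q u.
Proof.
move=> Qk Qx QD QM z; have [u <-] := proj_surj z.
elim/free_ind: u => [k|x|u v Qu Qv|u v Qu Qv].
- exact: Qk.
- exact: Qx.
- by rewrite rmorphD; apply: QD.
- by rewrite rmorphM; apply: QM.
Qed.

Fact cpoly_mulC : commutative (@GRing.mul cpoly).
Proof.
move=> y z; elim/cpoly_ind: y => [k|x|u v Hu Hv|u v Hu Hv].
- exact: scalarC.
- elim/cpoly_ind: z => [k|x'|u v Hu Hv|u v Hu Hv].
  + by rewrite scalarC.
  + apply/eqP; rewrite -subr_eq0 -!rmorphM -rmorphB.
    by apply/eqP/proj_gen/Commutator.
  + by rewrite mulrDl mulrDr Hu Hv.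
  + by rewrite mulrA Hu -mulrA Hv mulrA.
- by rewrite mulrDl mulrDr Hu Hv.
- by rewrite -mulrA Hv mulrA Hu mulrA.
Qed.

HB.instance Definition _ := GRing.PzRing_hasCommutativeMul.Build cpoly cpoly_mulC.

Section Lift.
Variables (D : comPzRingType) (phi : {rmorphism K -> D}) (g : X -> D).

(* The ring morphism K[X] -> D extending phi and g.                            *)
Definition cpoly_lift : cpoly -> D := quot_lift (free_lift phi g).

Let phiB : zmod_morphism phi. Proof. exact: rmorphB. Qed.
Let phiM : monoid_morphism phi.
Proof. by split; [apply: rmorph1|apply: rmorphM]. Qed.
Let phiC k d : phi k * d = d * phi k. Proof. exact: mulrC. Qed.
Let liftB := free_liftB g phiB phiM phiC.
Let liftM := free_liftM g phiB phiM phiC.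

Let lift_comm p : commutators p -> free_lift phi g p = 0.
Proof.
by case=> x x'; rewrite liftB !liftM.2 !free_lift_gen // mulrC subrr.
Qed.

HB.instance Definition _ :=
  GRing.isZmodMorphism.Build cpoly D cpoly_lift (quot_liftB liftB liftM lift_comm).
HB.instance Definition _ :=
  GRing.isMonoidMorphism.Build cpoly D cpoly_lift (quot_liftM liftB liftM lift_comm).

Lemma cpoly_lift_scalar k : cpoly_lift k%:S = phi k.
Proof. by rewrite [LHS]quot_lift_proj // free_lift_scalar. Qed.

Lemma cpoly_lift_var x : cpoly_lift (cvar x) = g x.
Proof. by rewrite [LHS]quot_lift_proj // free_lift_gen. Qed.

End Lift.
End Polynomials.

Arguments cvar {K X} x.

(* The localization K[f^-1], as K[t] / (f t - 1).                              *)
Section Localization.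
Variables (K : comPzRingType) (f : K).

Inductive loc_rel : cpoly K unit -> Prop :=
| Loc_rel : loc_rel (f%:S * cvar tt - 1).

Definition loc := quot loc_rel.
HB.instance Definition _ := PzAlgebra.on loc.
HB.instance Definition _ := GRing.ComPzRing.on loc.

Definition loc_inv : loc := proj loc_rel (cvar tt).

Lemma loc_invP : f%:S * loc_inv = 1.
Proof.
apply/eqP; rewrite -subr_eq0 -(rmorph1 (proj loc_rel)) -[f%:S]proj_scalar.
by rewrite -rmorphM -rmorphB; apply/eqP/proj_gen.
Qed.

End Localization.

Section GroupAlgebra.
Variables (K : comPzRingType) (G : groupType).

Inductive groupalg_rel : free K G -> Prop :=
| GA_one : groupalg_rel (fgen 1%g - 1)
| GA_mul (g h : G) : groupalg_rel (fgen (g * h)%g - fgen g * fgen h).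

Definition groupalg := quot groupalg_rel.
HB.instance Definition _ := PzAlgebra.on groupalg.

Definition gelt (g : G) : groupalg := proj groupalg_rel (fgen g).

Lemma gelt1 : gelt 1%g = 1.
Proof.
apply/eqP; rewrite -subr_eq0 -(rmorph1 (proj groupalg_rel)) -rmorphB.
by apply/eqP/proj_gen/GA_one.
Qed.

Lemma geltM g h : gelt (g * h)%g = gelt g * gelt h.
Proof.
apply/eqP; rewrite -subr_eq0 -rmorphM -rmorphB.
by apply/eqP/proj_gen/GA_mul.
Qed.

(* The K-algebra morphism K[G] -> D extending h : G -> D.                      *)
Definition groupalg_lift (D : pzAlgType K) (h : G -> D) : groupalg -> D :=
  quot_lift (free_lift (fun k : K => k%:S) h).

Lemma groupalg_lift_morphism (D : pzAlgType K) (h : G -> D) :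
    h 1%g = 1 -> (forall x y, h (x * y)%g = h x * h y) ->
  alg_morphism (groupalg_lift h) /\ forall x, groupalg_lift h (gelt x) = h x.
Proof.
move=> h1 hM; set phi := fun k : K => k%:S : D.
have phiB : zmod_morphism phi by apply: rmorphB.
have phiM : monoid_morphism phi by split; [apply: rmorph1|apply: rmorphM].
have phiC k d : phi k * d = d * phi k by apply: scalarC.
have LB := free_liftB h phiB phiM phiC; have LM := free_liftM h phiB phiM phiC.
have L0 p : groupalg_rel p -> free_lift phi h p = 0.
  by case=> [|x y]; rewrite LB ?LM.1 ?LM.2 !free_lift_gen // ?h1 ?hM subrr.
split=> [|x]; last by rewrite [LHS]quot_lift_proj // free_lift_gen.
split; [exact: quot_liftB LB LM L0|exact: quot_liftM LB LM L0|move=> k].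
by rewrite [LHS]quot_lift_proj // free_lift_scalar.
Qed.

End GroupAlgebra.

Arguments gelt {K G} g.

(* Extension of scalars B (x)_K L along phi : K -> L, as the L-algebra          *)
(* generated by the symbols b (x) 1, subject to the relations making            *)
(* b |-> b (x) 1 a ring morphism compatible with phi.                          *)
Section BaseChange.
Variables (K L : comPzRingType) (phi : {rmorphism K -> L}) (B : pzAlgType K).

Inductive tensor_rel : free L B -> Prop :=
| T_add (b c : B) : tensor_rel (fgen (b + c) - (fgen b + fgen c))
| T_mul (b c : B) : tensor_rel (fgen (b * c) - fgen b * fgen c)
| T_scalar (k : K) : tensor_rel (fgen k%:S - (phi k)%:S).

Definition tensor := quot tensor_rel.
HB.instance Definition _ := PzAlgebra.on tensor.

Definition tens1 (b : B) : tensor := proj tensor_rel (fgen b).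

Let proj_sub0 u v : tensor_rel (u - v) -> proj tensor_rel u = proj tensor_rel v.
Proof. by move=> uv; apply/proj_eq/ideal_in. Qed.

Lemma tens1_scalar (k : K) : tens1 k%:S = (phi k)%:S.
Proof. exact: proj_sub0 (T_scalar k). Qed.

Fact tens1D b c : tens1 (b + c) = tens1 b + tens1 c.
Proof. by rewrite /tens1 -rmorphD; apply/proj_sub0/T_add. Qed.

Fact tens1_is_monoid_morphism : monoid_morphism tens1.
Proof.
split=> [|b c]; first by rewrite -(rmorph1 (@scalar K B)) tens1_scalar !rmorph1.
by rewrite /tens1 -rmorphM; apply/proj_sub0/T_mul.
Qed.

Fact tens1_is_zmod_morphism : zmod_morphism tens1.
Proof.
move=> b c; rewrite tens1D; congr (_ + _); apply: (addIr (tens1 c)).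
by rewrite -tens1D !addNr -(rmorph0 (@scalar K B)) tens1_scalar !rmorph0.
Qed.

HB.instance Definition _ :=
  GRing.isZmodMorphism.Build B tensor tens1 tens1_is_zmod_morphism.
HB.instance Definition _ :=
  GRing.isMonoidMorphism.Build B tensor tens1 tens1_is_monoid_morphism.

(* The L-algebra morphism B (x)_K L -> D extending f : B -> D.                 *)
Definition tensor_lift (D : pzAlgType L) (f : B -> D) : tensor -> D :=
  quot_lift (free_lift (fun l : L => l%:S) f).

Lemma tensor_lift_morphism (D : pzAlgType L) (f : B -> D) :
    zmod_morphism f -> monoid_morphism f -> (forall k : K, f k%:S = (phi k)%:S) ->
  alg_morphism (tensor_lift f) /\ forall b, tensor_lift f (tens1 b) = f b.
Proof.
move=> fB fM fS; set psi := fun l : L => l%:S : D.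
have psiB : zmod_morphism psi by apply: rmorphB.
have psiM : monoid_morphism psi by split; [apply: rmorph1|apply: rmorphM].
have psiC l d : psi l * d = d * psi l by apply: scalarC.
have LB := free_liftB f psiB psiM psiC; have LM := free_liftM f psiB psiM psiC.
have f0 : f 0 = 0 by rewrite -(subrr 0) fB subrr.
have fD v w : f (v + w) = f v + f w.
  by rewrite -{1}[w]opprK fB -[- w]sub0r fB f0 sub0r opprK.
have LD v w : free_lift psi f (v + w) = free_lift psi f v + free_lift psi f w.
  rewrite -{1}[w]opprK LB -[- w]sub0r LB.
  by rewrite -(rmorph0 (@scalar L (free L B))) free_lift_scalar // /psi rmorph0
     sub0r opprK.
have L0 p : tensor_rel p -> free_lift psi f p = 0.
  case=> [b c|b c|k]; rewrite LB ?LD ?LM.2 !free_lift_gen //.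
  - by rewrite fD subrr.
  - by rewrite fM.2 subrr.
  - by rewrite free_lift_scalar // fS subrr.
split=> [|x]; last by rewrite [LHS]quot_lift_proj // free_lift_gen.
split; [exact: quot_liftB LB LM L0|exact: quot_liftM LB LM L0|move=> k].
by rewrite [LHS]quot_lift_proj // free_lift_scalar.
Qed.

End BaseChange.

Arguments tens1 {K L} phi {B} b.

Definition tensor_map (K L : comPzRingType) (phi : {rmorphism K -> L})
    (B D : pzAlgType K) (f : B -> D) : tensor phi B -> tensor phi D :=
  tensor_lift (fun b => tens1 phi (f b)).

Arguments tensor_map {K L} phi {B D} f _.

(* The braid group B_n on n strands.  Artin generators are numbered from 0:    *)
(* the letter (i, false) stands for s_(i+1), and (i, true) for its inverse.    *)
Section BraidGroup.
Variable n : nat.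

Definition bword := seq ('I_n.-1 * bool).

Inductive braid_eq : bword -> bword -> Prop :=
| braid_refl w : braid_eq w w
| braid_sym w w' : braid_eq w w' -> braid_eq w' w
| braid_trans w w' w'' : braid_eq w w' -> braid_eq w' w'' -> braid_eq w w''
| braid_cat w1 w1' w2 w2' :
    braid_eq w1 w1' -> braid_eq w2 w2' -> braid_eq (w1 ++ w2) (w1' ++ w2')
| braid_cancel i b : braid_eq [:: (i, b); (i, ~~ b)] [::]
| braid_artin (i j : 'I_n.-1) : i.+1 = j :> nat ->
    braid_eq [:: (i, false); (j, false); (i, false)]
             [:: (j, false); (i, false); (j, false)]
| braid_far (i j : 'I_n.-1) : (i.+1 < j)%N ->
    braid_eq [:: (i, false); (j, false)] [:: (j, false); (i, false)].

Definition braid_eqb : rel bword := fun w w' => `[< braid_eq w w' >].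

Lemma braid_eqb_refl : reflexive braid_eqb.
Proof. by move=> s; apply/asboolP; apply: braid_refl. Qed.
Lemma braid_eqb_sym : symmetric braid_eqb.
Proof. by move=> s t; apply: asbool_equiv_eq; split; apply: braid_sym. Qed.
Lemma braid_eqb_trans : transitive braid_eqb.
Proof.
move=> t s u /asboolP st /asboolP tu; apply/asboolP.
exact: braid_trans st tu.
Qed.

Canonical braid_equiv :=
  EquivRel braid_eqb braid_eqb_refl braid_eqb_sym braid_eqb_trans.

Definition braid := {eq_quot braid_equiv}.
HB.instance Definition _ := Choice.on braid.
HB.instance Definition _ := Quotient.on braid.

Definition bclass (w : bword) : braid := \pi_braid w.

Lemma bclass_eq w w' : bclass w = bclass w' <-> braid_eq w w'.
Proof. by split=> [/eqmodP/asboolP|ww'] //; apply/eqmodP/asboolP. Qed.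

Lemma bclass_surj : surjective bclass.
Proof. by move=> z; exists (repr z); apply: reprK. Qed.

Lemma repr_bclass w : braid_eq (repr (bclass w)) w.
Proof. by apply/bclass_eq; apply: reprK. Qed.

Definition binvw (w : bword) : bword := rev [seq (l.1, ~~ l.2) | l <- w].

Lemma braid_catV w : braid_eq (w ++ binvw w) [::].
Proof.
elim: w => [|[i b] w IHw]; first exact: braid_refl.
rewrite /binvw map_cons rev_cons -cats1 -cat1s -catA [w ++ _]catA.
apply: (braid_trans _ (braid_cancel i b)); apply: (braid_cat (braid_refl [:: _])).
exact: (braid_cat IHw (braid_refl [:: _])).
Qed.

Lemma binvwK : involutive binvw.
Proof.
move=> w; rewrite /binvw map_rev revK -map_comp -[RHS]map_id.
by apply: eq_map => -[i b] /=; rewrite negbK.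
Qed.

Lemma braid_catVl w : braid_eq (binvw w ++ w) [::].
Proof. by rewrite -{2}[w]binvwK; apply: braid_catV. Qed.

Lemma braid_inv w w' : braid_eq w w' -> braid_eq (binvw w) (binvw w').
Proof.
move=> ww'; apply: (@braid_trans _ (binvw w ++ (w' ++ binvw w'))).
  rewrite -{1}[binvw w]cats0; apply: braid_cat; first exact: braid_refl.
  exact/braid_sym/braid_catV.
rewrite catA -[X in braid_eq _ X]cat0s; apply: braid_cat; last exact: braid_refl.
apply: braid_trans (braid_catVl w); apply: braid_cat; first exact: braid_refl.
exact: braid_sym.
Qed.

Definition bone : braid := bclass [::].
Definition bmul (x y : braid) : braid := bclass (repr x ++ repr y).
Definition binv (x : braid) : braid := bclass (binvw (repr x)).

Lemma bmul_class w w' : bmul (bclass w) (bclass w') = bclass (w ++ w').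
Proof. by apply/bclass_eq; apply: braid_cat; apply: repr_bclass. Qed.
Lemma binv_class w : binv (bclass w) = bclass (binvw w).
Proof. by apply/bclass_eq/braid_inv/repr_bclass. Qed.

Fact bmulA : associative bmul.
Proof.
move=> x y z.
have [[[u <-] [v <-]] [w <-]] := (bclass_surj x, bclass_surj y, bclass_surj z).
by rewrite !bmul_class catA.
Qed.
Fact bmul1l : left_id bone bmul.
Proof. by move=> x; have [u <-] := bclass_surj x; rewrite bmul_class. Qed.
Fact bmul1r : right_id bone bmul.
Proof. by move=> x; have [u <-] := bclass_surj x; rewrite bmul_class cats0. Qed.
Fact bmulVl : left_inverse bone binv bmul.
Proof.
move=> x; have [u <-] := bclass_surj x; rewrite binv_class bmul_class.
exact/bclass_eq/braid_catVl.
Qed.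
Fact bmulVr : right_inverse bone binv bmul.
Proof.
move=> x; have [u <-] := bclass_surj x; rewrite binv_class bmul_class.
exact/bclass_eq/braid_catV.
Qed.

HB.instance Definition _ :=
  isGroup.Build braid bmulA bmul1l bmul1r bmulVl bmulVr.

Definition artin (i : 'I_n.-1) : braid := bclass [:: (i, false)].

Lemma artinV i : (artin i)^-1%g = bclass [:: (i, true)].
Proof. exact: binv_class. Qed.

Section Lift.
Variables (D : pzRingType) (s sV : 'I_n.-1 -> D).

(* The multiplicative map B_n -> D sending the generators to s, and their      *)
(* inverses to sV.                                                             *)
Definition bword_eval (w : bword) : D :=
  \prod_(l <- w) (if l.2 then sV l.1 else s l.1).

Definition braid_lift (x : braid) : D := bword_eval (repr x).

Hypotheses (ssV : forall i, s i * sV i = 1) (sVs : forall i, sV i * s i = 1).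
Hypothesis s_artin : forall i j : 'I_n.-1, i.+1 = j :> nat ->
  s i * s j * s i = s j * s i * s j.
Hypothesis s_far : forall i j : 'I_n.-1, (i.+1 < j)%N -> s i * s j = s j * s i.

Lemma braid_lift_class w : braid_lift (bclass w) = bword_eval w.
Proof.
rewrite /braid_lift; move: (repr _) (repr_bclass w) => w'; elim=> //=.
- by move=> ? ? ? _ -> _ ->.
- by move=> *; rewrite /bword_eval !big_cat /=; congr (_ * _).
- by move=> i [] /=; rewrite /bword_eval !big_cons big_nil /= mulr1.
- move=> i j ij; rewrite /bword_eval !big_cons big_nil /= !mulr1 !mulrA.
  exact: s_artin.
- by move=> i j ij; rewrite /bword_eval !big_cons big_nil /= !mulr1; apply: s_far.
Qed.

Lemma braid_lift1 : braid_lift 1%g = 1.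
Proof. by rewrite [LHS]braid_lift_class /bword_eval big_nil. Qed.

Lemma braid_liftM x y : braid_lift (x * y)%g = braid_lift x * braid_lift y.
Proof.
have [[u <-] [v <-]] := (bclass_surj x, bclass_surj y).
by rewrite [(_ * _)%g]bmul_class !braid_lift_class /bword_eval big_cat.
Qed.

Lemma braid_lift_artin i : braid_lift (artin i) = s i.
Proof. by rewrite braid_lift_class /bword_eval big_seq1. Qed.

Lemma braid_lift_artinV i : braid_lift (artin i)^-1%g = sV i.
Proof. by rewrite artinV braid_lift_class /bword_eval big_seq1. Qed.

End Lift.
End BraidGroup.

Definition bwiden n (w : bword n) : bword n.+1 :=
  [seq (widen_ord (leq_pred n) l.1, l.2) | l <- w].

Definition braid_incl n (x : braid n) : braid n.+1 := bclass (bwiden (repr x)).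

Lemma braid_incl_class n (w : bword n) :
  braid_incl (bclass w) = bclass (bwiden w).
Proof.
apply/bclass_eq; move: (repr _) (repr_bclass w) => w'; rewrite /bwiden; elim.
- by move=> *; apply: braid_refl.
- by move=> ? ? _; apply: braid_sym.
- by move=> ? ? ? _ h _; apply: braid_trans.
- by move=> *; rewrite !map_cat; apply: braid_cat.
- by move=> *; apply: braid_cancel.
- by move=> *; apply: braid_artin.
- by move=> *; apply: braid_far.
Qed.

Section BraidAlgebra.
Variables (K : comPzRingType) (n : nat).

Definition braidalg := groupalg K (braid n).
HB.instance Definition _ := PzAlgebra.on braidalg.

Definition bgen (i : 'I_n.-1) : braidalg := gelt (artin i).
Definition bgenV (i : 'I_n.-1) : braidalg := gelt (artin i)^-1%g.

End BraidAlgebra.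

Definition braidalg_incl (K : comPzRingType) n : braidalg K n -> braidalg K n.+1 :=
  groupalg_lift (fun x : braid n => gelt (braid_incl x) : braidalg K n.+1).

(* A = Q[a,x,x^-1]/(a^2-1)                                                     *)
Inductive Avar := A_a | A_x | A_xV.

Inductive Arel : cpoly rat Avar -> Prop :=
| Arel_x : Arel (cvar A_x * cvar A_xV - 1)
| Arel_a : Arel (cvar A_a ^+ 2 - 1).

Definition ringA : comPzRingType := quot Arel.
Definition aA : ringA := proj Arel (cvar A_a).
Definition xA : ringA := proj Arel (cvar A_x).
Definition xVA : ringA := proj Arel (cvar A_xV).

(* R = Q[a,b,c,(abc)^-1]                                                       *)
Inductive Rvar := R_a | R_b | R_c | R_abcV.

Inductive Rrel : cpoly rat Rvar -> Prop :=
| Rrel_abc : Rrel (cvar R_a * cvar R_b * cvar R_c * cvar R_abcV - 1).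

Definition ringR : comPzRingType := quot Rrel.
Definition aR : ringR := proj Rrel (cvar R_a).
Definition bR : ringR := proj Rrel (cvar R_b).
Definition cR : ringR := proj Rrel (cvar R_c).
Definition xR : ringR := bR + cR.
Definition yR : ringR := bR * cR.

(* S = R[x^-1] *)
Definition ringS : comPzRingType := loc xR.
Definition R_S : {rmorphism ringR -> ringS} := @scalar ringR (loc xR).
Definition xVS : ringS := loc_inv xR.

(* S_+ = S/(a-y) for e = false and S_- = S/(a+y) for e = true; the same        *)
(* convention on signs is used below                                           *)
Inductive Spm_rel (e : bool) : ringS -> Prop :=
| Spm_rel_a : Spm_rel e (R_S aR - (-1) ^+ e * R_S yR).

Definition ringSpm (e : bool) : comPzRingType := quot (Spm_rel e).
Definition S_Spm (e : bool) : {rmorphism ringS -> ringSpm e} := proj (Spm_rel e).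
Definition R_Spm (e : bool) : {rmorphism ringR -> ringSpm e} := S_Spm e \o R_S.

(* Sdd is S with two daggers *)
Inductive Sdd_rel : ringS -> Prop :=
| Sdd_rel_a : Sdd_rel (R_S aR ^+ 2 - 1)
| Sdd_rel_y : Sdd_rel (R_S yR - 1).

Definition ringSdd : comPzRingType := quot Sdd_rel.
Definition S_Sdd : {rmorphism ringS -> ringSdd} := proj Sdd_rel.
Definition R_Sdd : {rmorphism ringR -> ringSdd} := S_Sdd \o R_S.

Inductive Sddpm_rel (e : bool) : ringSdd -> Prop :=
| Sddpm_rel_a : Sddpm_rel e (R_Sdd aR - (-1) ^+ e).

Definition ringSddpm (e : bool) : comPzRingType := quot (Sddpm_rel e).
Definition Sdd_Sddpm (e : bool) : {rmorphism ringSdd -> ringSddpm e} :=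
  proj (Sddpm_rel e).

(* The morphism A -> Sdd, a |-> a, x |-> b + c.                                *)
Definition rat_Sdd : {rmorphism rat -> ringSdd} := R_Sdd \o @scalar rat (quot Rrel).

Definition Avar_Sdd (v : Avar) : ringSdd :=
  match v with
  | A_a => R_Sdd aR
  | A_x => R_Sdd (bR + cR)
  | A_xV => S_Sdd xVS
  end.

Definition A_Sdd_fun : ringA -> ringSdd := quot_lift (cpoly_lift rat_Sdd Avar_Sdd).

Fact A_Sdd_rel p : Arel p -> cpoly_lift rat_Sdd Avar_Sdd p = 0.
Proof.
case; rewrite rmorphB ?rmorphM ?rmorphXn rmorph1 /= !cpoly_lift_var /=.
  by rewrite -(rmorphM S_Sdd) [R_S _ * _]loc_invP rmorph1 subrr.
have -> : S_Sdd (R_S aR) ^+ 2 - 1 = S_Sdd (R_S aR ^+ 2 - 1).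
  by rewrite rmorphB rmorphXn rmorph1.
exact/proj_gen/Sdd_rel_a.
Qed.

Section ASdd.

Let fB := rmorphB (cpoly_lift rat_Sdd Avar_Sdd).
Let fM : monoid_morphism (cpoly_lift rat_Sdd Avar_Sdd).
Proof. by split; [apply: rmorph1|apply: rmorphM]. Qed.

HB.instance Definition _ :=
  GRing.isZmodMorphism.Build ringA ringSdd A_Sdd_fun (quot_liftB fB fM A_Sdd_rel).
HB.instance Definition _ :=
  GRing.isMonoidMorphism.Build ringA ringSdd A_Sdd_fun
    (quot_liftM fB fM A_Sdd_rel).

Definition A_Sdd : {rmorphism ringA -> ringSdd} := A_Sdd_fun.
Definition A_Sddpm (e : bool) : {rmorphism ringA -> ringSddpm e} :=
  Sdd_Sddpm e \o A_Sdd.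

Lemma A_Sdd_a : A_Sdd aA = R_Sdd aR.
Proof.
by rewrite [LHS](quot_lift_proj fB fM A_Sdd_rel) [LHS]cpoly_lift_var.
Qed.

Lemma A_Sdd_x : A_Sdd xA = R_Sdd (bR + cR).
Proof.
by rewrite [LHS](quot_lift_proj fB fM A_Sdd_rel) [LHS]cpoly_lift_var.
Qed.

End ASdd.

(* The morphism S_+- -> Sdd_+- induced by S -> Sdd -> Sdd_+-                   *)
Definition S_Sddpm (e : bool) : {rmorphism ringS -> ringSddpm e} :=
  Sdd_Sddpm e \o S_Sdd.

Definition Spm_Sddpm_fun (e : bool) : ringSpm e -> ringSddpm e :=
  quot_lift (S_Sddpm e).

Fact Spm_Sddpm_rel e p : Spm_rel e p -> S_Sddpm e p = 0.
Proof.
case=> {p}.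
have y1 : S_Sdd (R_S yR) = 1.
  by apply/eqP; rewrite -subr_eq0 -(rmorph1 S_Sdd) -rmorphB;
     apply/eqP/proj_gen/Sdd_rel_y.
have ae : Sdd_Sddpm e (R_Sdd aR) = (-1) ^+ e.
  apply/eqP; rewrite -subr_eq0 -(rmorph_sign (Sdd_Sddpm e)) -rmorphB.
  exact/eqP/proj_gen/Sddpm_rel_a.
by rewrite rmorphB rmorphM rmorph_sign /= y1 rmorph1 mulr1 ae subrr.
Qed.

Section SpmSddpm.
Variable e : bool.

Let gB := rmorphB (S_Sddpm e).
Let gM : monoid_morphism (S_Sddpm e).
Proof. by split; [apply: rmorph1|apply: rmorphM]. Qed.

HB.instance Definition _ :=
  GRing.isZmodMorphism.Build (ringSpm e) (ringSddpm e) (@Spm_Sddpm_fun e)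
    (quot_liftB gB gM (@Spm_Sddpm_rel e)).
HB.instance Definition _ :=
  GRing.isMonoidMorphism.Build (ringSpm e) (ringSddpm e) (@Spm_Sddpm_fun e)
    (quot_liftM gB gM (@Spm_Sddpm_rel e)).

Definition Spm_Sddpm : {rmorphism ringSpm e -> ringSddpm e} := @Spm_Sddpm_fun e.

Lemma Spm_Sddpm_S u : Spm_Sddpm (S_Spm e u) = Sdd_Sddpm e (S_Sdd u).
Proof. by rewrite [LHS](quot_lift_proj gB gM (@Spm_Sddpm_rel e)). Qed.

End SpmSddpm.

(* The algebra F_n.  The inverse of s_i is read off the cubic relation         *)
(* s_i^3 - (x+a) s_i^2 + (1+ax) s_i - a = 0, where a^2 = 1.                    *)
Section FAlgebra.
Variable n : nat.

Inductive Fvar := F_s of 'I_n.-1 | F_e of 'I_n.-1 | F_C.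

Local Notation s i := (fgen (F_s i) : free ringA Fvar).
Local Notation e i := (fgen (F_e i) : free ringA Fvar).
Local Notation C := (fgen F_C : free ringA Fvar).
Local Notation a := (aA%:S : free ringA Fvar).
Local Notation x := (xA%:S : free ringA Fvar).
Local Notation xV := (xVA%:S : free ringA Fvar).
Local Notation sV i := (a * (s i ^+ 2 - (x + a) * s i + (1 + a * x))).

Definition adjacent (i j : 'I_n.-1) := i.+1 = j :> nat \/ j.+1 = i :> nat.

Inductive Frel : free ringA Fvar -> Prop :=
| Frel_artin (i j : 'I_n.-1) : i.+1 = j :> nat ->
    Frel (s i * s j * s i - s j * s i * s j)
| Frel_far (i j : 'I_n.-1) : (i.+1 < j)%N -> Frel (s i * s j - s j * s i)
| Frel_cubic i : Frel ((s i - a) * (s i ^+ 2 - x * s i + 1))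
| Frel_e i : Frel (e i - a * (xV * (sV i + s i) - 1))
| Frel_se i : Frel (s i * e i - a * e i)
| Frel_ese i j : adjacent i j -> Frel (e i * s j * e i - (e i + C))
| Frel_esVe i j : adjacent i j -> Frel (e i * sV j * e i - (e i + C))
| Frel_sC i : Frel (s i * C - a * C)
| Frel_Cs i : Frel (C * s i - a * C).

Definition Falg := quot Frel.
HB.instance Definition _ := PzAlgebra.on Falg.

Definition Fs (i : 'I_n.-1) : Falg := proj Frel (s i).
Definition FsV (i : 'I_n.-1) : Falg := proj Frel (sV i).
Definition Fe (i : 'I_n.-1) : Falg := proj Frel (e i).
Definition FC : Falg := proj Frel C.

Let Frel_eq u v : Frel (u - v) -> proj Frel u = proj Frel v.
Proof. by move=> uv; apply/proj_eq/ideal_in. Qed.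

Lemma aA2 : aA * aA = 1.
Proof.
apply/eqP; rewrite -subr_eq0 -rmorphM -(rmorph1 (proj Arel)) -rmorphB.
exact/eqP/proj_gen/Arel_a.
Qed.

Let cubic_inv (D : pzRingType) (t u v : D) :
    t * u = u * t -> t * v = v * t -> u * v = v * u -> u * u = 1 ->
    (t - u) * (t ^+ 2 - v * t + 1) = 0 ->
  t * (u * (t ^+ 2 - (v + u) * t + (1 + u * v))) = 1 /\
  u * (t ^+ 2 - (v + u) * t + (1 + u * v)) * t = 1.
Proof.
move=> tu tv uv uu cub; set w := u * _.
have tw : t * w = w * t.
  have comm_w : GRing.comm t w.
    apply: commrM => //; apply: commrD.
      by apply: commrB; [apply: commrX|apply: commrM => //; apply: commrD].
    by apply: commrD; [apply: commr1|apply: commrM].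
  exact: comm_w.
suff tw1 : t * w = 1 by rewrite -tw.
rewrite /w mulrA tu -mulrA -[RHS]uu -[X in _ = u * X]add0r -cub; congr (u * _).
rewrite mulrBl !(mulrDr, mulrN, mulr1) opprD !mulrDl !mulrA tv.
have -> : t * u * v = u * v * t by rewrite tu -mulrA tv mulrA.
rewrite mulrDr !mulrA tv tu opprD addrA [in RHS]addrA subrK opprB !addrA.
by rewrite (addrAC _ (- (u * t * t))) (addrAC _ (- (u * t * t))).
Qed.

Lemma FsVE i : FsV i =
  aA%:S * (Fs i ^+ 2 - (xA%:S + aA%:S) * Fs i + (1 + aA%:S * xA%:S)).
Proof.
rewrite /FsV !expr2 !(rmorphM, rmorphD, rmorphN, rmorph1).
by [].
Qed.

Lemma Fs_cubic i :
  (Fs i - aA%:S) * (Fs i ^+ 2 - xA%:S * Fs i + 1) = 0.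
Proof.
have := proj_gen (Frel_cubic i).
by rewrite !expr2 !(rmorphM, rmorphD, rmorphN, rmorph1).
Qed.

Let FsVP i : Fs i * FsV i = 1 /\ FsV i * Fs i = 1.
Proof.
rewrite FsVE; apply: cubic_inv.
- by rewrite scalarC.
- by rewrite scalarC.
- by rewrite scalarC.
- by rewrite -rmorphM aA2 rmorph1.
- exact: Fs_cubic.
Qed.

Lemma FsFsV i : Fs i * FsV i = 1. Proof. by have [] := FsVP i. Qed.
Lemma FsVFs i : FsV i * Fs i = 1. Proof. by have [] := FsVP i. Qed.

Lemma Fs_artin (i j : 'I_n.-1) : i.+1 = j :> nat ->
  Fs i * Fs j * Fs i = Fs j * Fs i * Fs j.
Proof. by move=> ij; have := Frel_eq (Frel_artin ij); rewrite !rmorphM. Qed.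

Lemma Fs_far (i j : 'I_n.-1) : (i.+1 < j)%N -> Fs i * Fs j = Fs j * Fs i.
Proof. by move=> ij; have := Frel_eq (Frel_far ij); rewrite !rmorphM. Qed.

(* The A-algebra morphism A B_n -> F_n, s_i |-> s_i.                           *)
Definition F_of_braid : braidalg ringA n -> Falg :=
  groupalg_lift (braid_lift Fs FsV).

Lemma F_of_braidP : alg_morphism F_of_braid /\
  forall i, F_of_braid (bgen ringA i) = Fs i.
Proof.
have [|x y|mor liftE] := @groupalg_lift_morphism ringA _ Falg (braid_lift Fs FsV).
- exact: braid_lift1 FsFsV FsVFs Fs_artin Fs_far.
- exact: braid_liftM FsFsV FsVFs Fs_artin Fs_far x y.
split=> // i; rewrite [LHS]liftE.
exact: braid_lift_artin FsFsV FsVFs Fs_artin Fs_far i.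
Qed.

End FAlgebra.

Section Hecke.
Variable n : nat.

Inductive Hrel : braidalg ringR n -> Prop :=
| Hrel_cubic (i : 'I_n.-1) : Hrel
    ((bgen ringR i - aR%:S) * (bgen ringR i - bR%:S) * (bgen ringR i - cR%:S)).

Definition Halg := quot Hrel.
HB.instance Definition _ := PzAlgebra.on Halg.

Definition Hs (i : 'I_n.-1) : Halg := proj Hrel (bgen ringR i).
Definition HsV (i : 'I_n.-1) : Halg := proj Hrel (bgenV ringR i).

End Hecke.

Section BMWtilde.
Variable n : nat.

Local Notation s := (@Hs n).
Local Notation sV := (@HsV n).
Local Notation x := (xR%:S : Halg n).
Local Notation y := (yR%:S : Halg n).

(* The indices i, j stand for i, i + 1.                                        *)
Inductive BMWt_rel : Halg n -> Prop :=
| BMWt_R (i j : 'I_n.-1) : i.+1 = j :> nat -> BMWt_rel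
    (- y * s i * sV j * s i + y ^+ 2 * sV j * s i * sV j - s i * s j * s i
     - x * y ^+ 2 * sV j ^+ 2 + x * s i ^+ 2 + y ^+ 3 * sV j * sV i * sV j).

Definition BMWtalg := quot BMWt_rel.
HB.instance Definition _ := PzAlgebra.on BMWtalg.

End BMWtilde.

Section BMWpm.
Variables (n : nat) (e : bool).

Definition HSpm := tensor (R_Spm e) (Halg n).
HB.instance Definition _ := PzAlgebra.on HSpm.

Definition HSpm_s (i : 'I_n.-1) : HSpm := tens1 (R_Spm e) (Hs i).
Definition HSpm_sV (i : 'I_n.-1) : HSpm := tens1 (R_Spm e) (HsV i).

(* e_i = (a s_i^-1 +- s_i)/x -+ 1                                              *)
Definition HSpm_e (i : 'I_n.-1) : HSpm :=
  (S_Spm e xVS)%:S * ((R_Spm e aR)%:S * HSpm_sV i + (-1) ^+ e * HSpm_s i)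
  - (-1) ^+ e.

Inductive BMWpm_rel : HSpm -> Prop :=
| BMWpm_ese (i j : 'I_n.-1) : i = 0%N :> nat -> j = 1%N :> nat ->
    BMWpm_rel (HSpm_e i * HSpm_s j * HSpm_e i - HSpm_e i)
| BMWpm_esVe (i j : 'I_n.-1) : i = 0%N :> nat -> j = 1%N :> nat ->
    BMWpm_rel (HSpm_e i * HSpm_sV j * HSpm_e i - HSpm_e i).

Definition BMWpm := quot BMWpm_rel.
HB.instance Definition _ := PzAlgebra.on BMWpm.

Definition BMWpm_s (i : 'I_n.-1) : BMWpm := proj BMWpm_rel (HSpm_s i).
Definition BMWpm_e (i : 'I_n.-1) : BMWpm := proj BMWpm_rel (HSpm_e i).

End BMWpm.

(* Markov traces (t_m)_(m >= 1); the map t 0 is irrelevant.  In B_(m+2), the   *)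
(* Artin generator s_(m+1) has index ord_max.                                  *)
Section MarkovTraces.
Variables (M : lmodType ringA) (t : forall m : nat, braidalg ringA m -> M).

Definition markov_trace :=
  [/\ forall m, mod_linear (@t m.+1),
      forall m (u v : braidalg ringA m.+1), t (u * v) = t (v * u),
      forall m (u : braidalg ringA m.+1),
        t (braidalg_incl u * bgen ringA (ord_max : 'I_m.+2.-1)) = t u
    & forall m (u : braidalg ringA m.+1),
        t (braidalg_incl u * bgenV ringA (ord_max : 'I_m.+2.-1)) = t u].

Definition factors_through_F :=
  forall m, (3 <= m)%N -> exists2 t' : Falg m -> M,
    mod_linear t' & forall u, t u = t' (F_of_braid u).

End MarkovTraces.

(* Main.v *)
(* Let s, t be two consecutive generators, e, f the corresponding e_i, and
   delta = 2/x - a. In F_n one finds e^2 = delta e,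
   e f e = e + (2a/x) C and then e t s = a e f - C; applying the latter twice gives
   e t s s t = e, that is, t^-1 e t^-1 = s f s. Since s + s^-1 = x (a e + 1), this is
   exactly the vanishing of R_i at y = 1, whence (1), and it also rewrites
   t s^-1 t, so that F_(k+1) is spanned by F_k, F_k s_k F_k and F_k s_k^-1 F_k.
   (2) All the relations e_i s_(i+-1)^(+-1) e_i = e_i follow from those with
   i = 1 by conjugation in the braid group. This yields F_n -> BMW_n, and an
   inverse BMW_n -> F_n / (C); as every s_i acts on C by a, the ideal (C) is the
   span of C.
   (4) It suffices to show that a trace d whose three values vanish is zero. If d_n = 0
   with n >= 3, then d_(n+1) kills F_n s_n^(+-1) F_n, and, conjugating by
   s_(k+1), it kills all the F_k s_k^(+-1) F_k. Then 0 = d(e_1^2 s_2) = d(e_1) + d(C)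
   and d(C) = a d(C s_n) = 0, so that d(e_1) = -a d(1) vanishes, and d_(n+1) = 0
   by the spanning property. *)
Require Import Defs.
From HB Require Import structures.
From mathcomp Require Import all_boot all_order all_algebra.
From mathcomp Require Import ring.

Set Implicit Arguments.
Unset Strict Implicit.
Unset Printing Implicit Defensive.

Import GRing.Theory.
Local Open Scope ring_scope.

(** * Inverses and braid relations in a ring *)

Lemma mulr_eq1_uniq (B : pzRingType) (u v w : B) : v * u = 1 -> u * w = 1 -> v = w.
Proof. by move=> vu uw; rewrite -[v]mulr1 -uw mulrA vu mul1r. Qed.

Section BraidInverse.
Variables (B : pzRingType) (s sV t tV : B).
Hypotheses (ssV : s * sV = 1) (sVs : sV * s = 1) (ttV : t * tV = 1) (tVt : tV * t = 1).

Lemma comm_inv : s * t = t * s -> sV * tV = tV * sV.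
Proof.
move=> st; apply: (@mulr_eq1_uniq _ (t * s)).
  by rewrite -!mulrA [tV * _]mulrA tVt mul1r.
by rewrite -st -mulrA [t * _]mulrA ttV mul1r.
Qed.

Lemma comm_invl : s * t = t * s -> sV * t = t * sV.
Proof.
by move=> st; rewrite -[LHS]mulr1 -ssV mulrA -[_ * t * s]mulrA -st mulrA sVs mul1r.
Qed.

Hypothesis br : s * t * s = t * s * t.

Lemma artin_inv : sV * tV * sV = tV * sV * tV.
Proof.
apply: (@mulr_eq1_uniq _ (s * t * s)).
  by rewrite -!mulrA [sV * (s * _)]mulrA sVs mul1r [tV * _]mulrA tVt mul1r.
by rewrite br -!mulrA [t * (tV * _)]mulrA ttV mul1r [s * _]mulrA ssV mul1r.
Qed.

(** Trades two letters in t for a single one between letters in s. Both the spanning argument and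
    the conjugation of traces use it in this form. *)
Lemma artin_sV : t * s * tV = sV * t * s.
Proof.
rewrite -[LHS]mul1r -sVs -mulrA [s * _]mulrA [s * (t * s)]mulrA br.
by rewrite -!mulrA ttV mulr1.
Qed.

Lemma artin_sVV : t * sV * tV = sV * tV * s.
Proof.
have -> : t * sV * tV = t * (sV * tV * sV) * s by rewrite -!mulrA sVs mulr1.
by rewrite artin_inv !mulrA ttV mul1r.
Qed.

End BraidInverse.

(** * Consequences of the relations of [F_n] for one and for two generators *)

Section CubicQuotient.
Variables (K : comPzRingType) (B : pzAlgType K).

Lemma mulr_scalar (k : K) (u v : B) : u * (k%:S * v) = k%:S * (u * v).
Proof. by rewrite mulrA -scalarC mulrA. Qed.

Lemma scalar_mulA (k l : K) (u : B) : k%:S * (l%:S * u) = (k * l)%:S * u.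
Proof. by rewrite mulrA -rmorphM. Qed.

Variables a x xV : K.
Hypotheses (aa : a * a = 1) (xxV : x * xV = 1).

(** The formula of [e_i] for any invertible s, so that the same computations serve in every target
    algebra. It is locked so that rewriting treats it as a symbol. *)
Definition cup (s sV : B) : B := locked (a%:S * (xV%:S * (sV + s) - 1)).

Lemma cupE s sV : cup s sV = a%:S * (xV%:S * (sV + s) - 1).
Proof. by rewrite /cup -lock. Qed.

Let delta : K := xV *+ 2 - a.

Let mulSa (u : B) : a%:S * (a%:S * u) = u.
Proof. by rewrite scalar_mulA aa rmorph1 mul1r. Qed.

Lemma cupC s sV : cup s sV = cup sV s.
Proof. by rewrite !cupE [sV + s]addrC. Qed.

Lemma add_inv s sV : sV + s = x%:S * (a%:S * cup s sV + 1).
Proof. by rewrite !cupE mulSa subrK scalar_mulA xxV rmorph1 mul1r. Qed.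

Section OneGenerator.
Variables s sV : B.
Hypotheses (ssV : s * sV = 1) (sVs : sV * s = 1).

Lemma quadE : s ^+ 2 - x%:S * s + 1 = (x * a)%:S * cup s sV * s.
Proof.
have -> : (x * a)%:S * cup s sV = sV + s - x%:S.
  by rewrite (add_inv s sV) mulrDr mulr1 addrK scalar_mulA.
by rewrite mulrBl mulrDl sVs expr2 addrC addrA.
Qed.

Lemma comm_cup : s * cup s sV = cup s sV * s.
Proof.
rewrite !cupE mulr_scalar -mulrA; congr (_ * _).
by rewrite mulrBr mulrBl mulr1 mul1r mulr_scalar -mulrA mulrDr mulrDl ssV sVs.
Qed.

(** By [quadE] the quadratic factor is x a e s, with x, a and s invertible. The cubic relation
    therefore says that s - a annihilates e. *)
Lemma cubic_cup :
  (s - a%:S) * (s ^+ 2 - x%:S * s + 1) = 0 <-> s * cup s sV = a%:S * cup s sV.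
Proof.
have -> : (s - a%:S) * (s ^+ 2 - x%:S * s + 1) =
    (x * a)%:S * (s * cup s sV - a%:S * cup s sV) * s.
  by rewrite quadE -mulrA mulr_scalar -mulrBl !mulrA.
split=> [h|->]; last by rewrite subrr mulr0 mul0r.
apply/eqP; rewrite -subr_eq0; apply/eqP.
(* Cancel s on the right and x a on the left; as a^2 = 1, the inverse of x a is a xV. *)
have /(congr1 (fun u => (a * xV)%:S * (u * sV))) := h.
rewrite mul0r mulr0 -!mulrA ssV mulr1 scalar_mulA => <-.
suff -> : a * xV * (x * a) = 1 by rewrite rmorph1 mul1r.
by transitivity ((a * a) * (x * xV)); [ring|rewrite aa xxV mulr1].
Qed.

Lemma scalar_inv (w : B) : w * s = a%:S * w -> w * sV = a%:S * w.
Proof. by move=> ws; rewrite -{1}[w]mulSa -ws -!mulrA ssV mulr1 ws. Qed.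

Lemma inv_scalar (w : B) : s * w = a%:S * w -> sV * w = a%:S * w.
Proof. by move=> sw; rewrite -{1}[w]mulSa mulr_scalar -sw [sV * _]mulrA sVs mul1r sw. Qed.

Hypothesis se : s * cup s sV = a%:S * cup s sV.

Lemma es : cup s sV * s = a%:S * cup s sV.
Proof. by rewrite -comm_cup. Qed.

Lemma sVe : sV * cup s sV = a%:S * cup s sV.
Proof. exact: inv_scalar. Qed.

Lemma cup2 : cup s sV * cup s sV = delta%:S * cup s sV.
Proof.
rewrite {1}cupE -mulrA mulrBl mul1r -mulrA mulrDl sVe se -mulrDl -rmorphD scalar_mulA.
rewrite mulrBr scalar_mulA -mulrBl -rmorphB; congr (_%:S * _).
by rewrite /delta; transitivity ((a * a) * xV *+ 2 - a); [ring|rewrite aa mul1r].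
Qed.

Lemma sqrE : s * s = x%:S * s - 1 + x%:S * cup s sV.
Proof.
have := congr1 (fun u => u * s) (add_inv s sV).
rewrite mulrDl sVs -!mulrA mulrDl mul1r -mulrA es mulSa mulrDr [RHS]addrC => e.
by rewrite -[s * s](addKr 1) e addrCA addrA.
Qed.

Lemma invE : sV = (x * a)%:S * cup s sV + x%:S - s.
Proof. by apply: (canRL (addrK _)); rewrite add_inv mulrDr mulr1 scalar_mulA. Qed.

(** The presentation of [F_n] encodes the inverse of a generator by this polynomial. A morphism out
    of [F_n] must send it to the prescribed inverse sV. *)
Lemma cubic_invE :
  a%:S * (s ^+ 2 - (x%:S + a%:S) * s + (1 + a%:S * x%:S)) = sV.
Proof.
have -> : s ^+ 2 - (x%:S + a%:S) * s + (1 + a%:S * x%:S) =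
    (s ^+ 2 - x%:S * s + 1) - a%:S * (s - x%:S).
  by rewrite mulrDl !opprD mulrBr opprB !addrA [LHS](ACl (1*2*4*5*3)).
rewrite quadE -mulrA es mulrBr !scalar_mulA aa rmorph1 mul1r.
rewrite [RHS]invE -[RHS]addrA -[in RHS](opprB s).
by congr (_%:S * _ - _); rewrite mulrCA -mulrA aa mulr1 mulrC.
Qed.

(** Both s and s^-1 multiply w by a, because a^-1 = a. So e multiplies it by a (2 a / x - 1) =
    delta. *)
Lemma cup_fix (w : B) : s * w = a%:S * w -> cup s sV * w = delta%:S * w.
Proof.
move=> sw.
rewrite {1}cupE -mulrA mulrBl mul1r -mulrA mulrDl inv_scalar // sw.
rewrite -mulrDl -rmorphD scalar_mulA mulrBr scalar_mulA -mulrBl -rmorphB; congr (_%:S * _).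
by rewrite /delta; transitivity ((a * a) * xV *+ 2 - a); [ring|rewrite aa mul1r].
Qed.

End OneGenerator.

Lemma conj_inv (s sV t tV w : B) : s * sV = 1 -> sV * s = 1 ->
  t * tV = 1 -> tV * t = 1 -> w * t = s * w -> w * tV = sV * w.
Proof.
move=> ssV sVs ttV tVt h.
by rewrite -[LHS]mul1r -sVs -mulrA [s * _]mulrA -h -!mulrA ttV mulr1.
Qed.

Lemma conj_cup (s sV t tV w : B) : s * sV = 1 -> sV * s = 1 ->
  t * tV = 1 -> tV * t = 1 -> w * t = s * w -> w * cup t tV = cup s sV * w.
Proof.
move=> ssV sVs ttV tVt h.
rewrite !cupE mulr_scalar -mulrA; congr (_ * _).
rewrite mulrBr mulrBl mulr1 mul1r mulr_scalar -mulrA mulrDr mulrDl h.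
by rewrite (@conj_inv s sV t tV w).
Qed.


(** The relations of two adjacent generators, listed for both orders and both exponents. The record
    is thus stable under exchange ([Fpair_sym]) and inversion ([Fpair_inv]), and each identity below
    needs a proof for one configuration only. *)
Record Fpair (s sV t tV C : B) : Prop := {
  Fp_ssV : s * sV = 1; Fp_sVs : sV * s = 1;
  Fp_ttV : t * tV = 1; Fp_tVt : tV * t = 1;
  Fp_braid : s * t * s = t * s * t;
  Fp_se : s * cup s sV = a%:S * cup s sV;
  Fp_tf : t * cup t tV = a%:S * cup t tV;
  Fp_ete : cup s sV * t * cup s sV = cup s sV + C;
  Fp_etVe : cup s sV * tV * cup s sV = cup s sV + C;
  Fp_fsf : cup t tV * s * cup t tV = cup t tV + C;
  Fp_fsVf : cup t tV * sV * cup t tV = cup t tV + C;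
  Fp_sC : s * C = a%:S * C; Fp_Cs : C * s = a%:S * C;
  Fp_tC : t * C = a%:S * C; Fp_Ct : C * t = a%:S * C }.

Lemma Fpair_sym s sV t tV C : Fpair s sV t tV C -> Fpair t tV s sV C.
Proof. by case=> *; split. Qed.

(** [cup] is unchanged when s and s^-1 are exchanged, the relations with t and t^-1 are swapped, and
    the eigenvalue a is its own inverse. *)
Lemma Fpair_inv s sV t tV C : Fpair s sV t tV C -> Fpair sV s tV t C.
Proof.
case=> ssV sVs ttV tVt br se tf ete etVe fsf fsVf sC Cs tC Ct.
split; rewrite // ?[cup sV s]cupC ?[cup tV t]cupC //.
- exact: artin_inv br.
- exact: sVe sVs se.
- exact: sVe tVt tf.
- exact (inv_scalar sVs sC).
- exact (scalar_inv ssV Cs).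
- exact (inv_scalar tVt tC).
- exact (scalar_inv ttV Ct).
Qed.

Section TwoGenerators.
Variables s sV t tV C : B.
Hypothesis h : Fpair s sV t tV C.
Local Notation e := (cup s sV).
Local Notation f := (cup t tV).

Lemma conj_ts_cup : t * s * f = e * (t * s).
Proof. by case: h => *; apply: conj_cup => //; rewrite mulrA. Qed.

Lemma cup_C : e * C = delta%:S * C.
Proof. by case: h => *; apply: cup_fix. Qed.

(** Expand the middle f by its formula. In the result e has coefficient 2 a / x - a delta = a^2 = 1,
    and the two copies of C contribute 2 a / x. *)
Lemma efe : e * f * e = e + (a * xV *+ 2)%:S * C.
Proof.
case: h => ssV sVs _ _ _ se _ ete etVe _ _ _ _ _ _.
rewrite [f]cupE.
have m (u : B) : e * (a%:S * (xV%:S * u - 1)) * e =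
    a%:S * (xV%:S * (e * u * e) - delta%:S * e).
  rewrite mulr_scalar -mulrA; congr (_ * _).
  by rewrite mulrBr mulr1 mulrBl mulr_scalar !mulrA (cup2 sVs se).
rewrite m [e * _]mulrDr mulrDl etVe ete -mulr2n -[(e + C) *+ 2]mulr_natl.
have nS (k : K) (u : B) : k%:S * (2%:R * u) = (k *+ 2)%:S * u.
  by rewrite mulrA mulr_natr -rmorphMn.
rewrite nS mulrBr !scalar_mulA mulrDr addrAC mulrnAr; congr (_ + _).
rewrite -mulrBl -rmorphB.
suff -> : a * xV *+ 2 - a * delta = 1 by rewrite rmorph1 mul1r.
by rewrite -[RHS]aa /delta; ring.
Qed.

(** Evaluate e f e t s in two ways. By [efe] it is e t s + (2 a / x) C. Moving t s across e instead
    gives e f t s f = a e f s f = a e f + a delta C. The difference of the coefficients of C is a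
    delta - 2 a / x = - 1. *)
Lemma ets : e * t * s = a%:S * (e * f) - C.
Proof.
have := efe; have := conj_ts_cup; have := cup_C; move: (h).
case=> _ _ ttV tVt _ _ tf _ _ fsf _ _ Cs _ Ct eC c efe.
have : e * f * e * (t * s) = a%:S * (e * f) + (a * delta)%:S * C.
  rewrite -mulrA -c.
  have -> : e * f * (t * s * f) = e * (f * t) * (s * f) by rewrite !mulrA.
  rewrite (es ttV tVt tf) mulr_scalar -!mulrA [f * (s * f)]mulrA fsf -scalar_mulA
    -mulrDr -eC.
  by rewrite -mulrDr.
rewrite efe mulrDl -[_ * C * _]mulrA [C * _]mulrA Ct -[a%:S * C * s]mulrA Cs mulSa.
move/(canRL (addrK _)); rewrite mulrA => ->.
rewrite -addrA -mulrBl -rmorphB.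
have -> : a * delta - a * xV *+ 2 = - 1 by rewrite -aa /delta; ring.
by rewrite rmorphN rmorph1 mulN1r.
Qed.

End TwoGenerators.

(** Apply [ets] to the pair and then to the exchanged pair: the product becomes e f e - a delta C -
    C. By [efe] the coefficient of C is 2 a / x - a delta - 1 = 0. *)
Lemma etsst s sV t tV C : Fpair s sV t tV C ->
  cup s sV * t * s * s * t = cup s sV.
Proof.
move=> h; have h' := Fpair_sym h; have := ets h'; have := efe h; have := cup_C h.
rewrite (ets h); case: h => _ _ _ _ _ _ _ _ _ _ _ _ Cs _ Ct eC efe fst.
rewrite !mulrBl Cs -[a%:S * C * t]mulrA Ct mulSa.
rewrite -!mulrA [_ * (s * t)]mulrA fst !mulrBr mulr_scalar mulSa mulrA efe eC.
rewrite scalar_mulA -!addrA -[RHS]addr0; congr (_ + _).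
have nC : - C = (-1)%:S * C by rewrite rmorphN rmorph1 mulN1r.
rewrite nC -mulNr -rmorphN -!mulrDl -!rmorphD.
rewrite -[RHS](mul0r C) -(rmorph0 (@Defs.scalar K B)).
by congr (_%:S * _); rewrite -aa /delta; ring.
Qed.

(** Since s f = t^-1 e t s, the right side equals t^-1 (e t s s t) t^-1, to which [etsst]
    applies. *)
Lemma conj_inv_cup s sV t tV C : Fpair s sV t tV C ->
  tV * cup s sV * tV = s * cup t tV * s.
Proof.
move=> h; have et := etsst h; have c := conj_ts_cup h.
have -> : s * cup t tV * s = tV * (t * s * cup t tV) * s.
  by rewrite !mulrA (Fp_tVt h) mul1r.
by rewrite c -{1}et -!mulrA (Fp_ttV h) mulr1.
Qed.

(* With s + s^-1 = x (a e + 1), the element R_1 is, at y = 1,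
   a x (t^-1 e t^-1 - s f s). *)
Lemma BMWt_rel0 s sV t tV C : Fpair s sV t tV C ->
  - (s * tV * s) + tV * s * tV - s * t * s - x%:S * (tV * tV) + x%:S * (s * s)
  + tV * sV * tV = 0.
Proof.
move=> h; have c := conj_inv_cup h.
have m (p q r : B) : p * q * p + p * r * p = p * (q + r) * p by rewrite mulrDr mulrDl.
have n (p r rV : B) : p * (rV + r) * p - x%:S * (p * p) = (x * a)%:S * (p * cup r rV * p).
  apply: (canLR (addrK _));
    rewrite add_inv mulr_scalar mulrDr mulr1 mulr_scalar -mulrA mulrDl.
  by rewrite mulrDr -scalar_mulA -!mulrA.
transitivity ((tV * sV * tV + tV * s * tV - x%:S * (tV * tV))
  - (s * tV * s + s * t * s - x%:S * (s * s))).
  by rewrite !opprD opprK !addrA [LHS](ACl (6*2*4*1*3*5)).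
by rewrite !m !n c subrr.
Qed.

(** Substitute s^-1 = x a e + x - s. The term t e t is s^-1 f s^-1 by [conj_inv_cup] for the inverse
    generators. This is the rewriting rule that the braid relations alone do not give. *)
Lemma tsVtE s sV t tV C : Fpair s sV t tV C ->
  t * sV * t = (x * a)%:S * (sV * cup t tV * sV) + x%:S * (t * t) - s * t * s.
Proof.
move=> h; have := conj_inv_cup (Fpair_inv h).
rewrite ![cup tV t]cupC ![cup sV s]cupC => <-.
rewrite {1}(invE s sV) mulrBr mulrBl mulrDr mulrDl (Fp_braid h) mulr_scalar.
by rewrite -scalarC -!mulrA.
Qed.

End CubicQuotient.

(** * Restriction of scalars, opposite algebras and universal properties *)

Definition pack_rmorphism (B D : pzRingType) (f : B -> D)
    (fB : zmod_morphism f) (fM : monoid_morphism f) : {rmorphism B -> D} :=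
  HB.pack f (GRing.isZmodMorphism.Build B D f fB)
    (GRing.isMonoidMorphism.Build B D f fM).

Definition scalar_morph (K : comPzRingType) (B D : pzAlgType K) (f : B -> D) :=
  forall k : K, f k%:S = k%:S.

Lemma rmorph_alg_morphism (K : comPzRingType) (B D : pzAlgType K)
    (f : {rmorphism B -> D}) : scalar_morph f -> alg_morphism f.
Proof. by split=> //; [exact: rmorphB|split; [exact: rmorph1|exact: rmorphM]]. Qed.

(** D seen as a K-algebra along [phi]: morphisms from an extension of scalars to D correspond to
    K-algebra morphisms to [restr phi D]. The alias keeps the two scalar structures on D apart. *)
Definition restr (K L : comPzRingType) (phi : {rmorphism K -> L})
  (D : pzAlgType L) : Type := D.

Section Restr.
Variables (K L : comPzRingType) (phi : {rmorphism K -> L}) (D : pzAlgType L).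
HB.instance Definition _ := GRing.PzRing.copy (restr phi D) D.

Let restr_scalar (k : K) : restr phi D := (phi k)%:S : D.
Let restr_scalarB : zmod_morphism restr_scalar.
Proof. by move=> k l; rewrite /restr_scalar !rmorphB. Qed.
Let restr_scalarM : monoid_morphism restr_scalar.
Proof. by rewrite /restr_scalar; split=> [|k l]; rewrite ?rmorph1 // !rmorphM. Qed.
Let restr_scalarC k (u : restr phi D) : restr_scalar k * u = u * restr_scalar k.
Proof. exact: (@scalarC L D). Qed.
HB.instance Definition _ :=
  hasScalars.Build K (restr phi D) restr_scalarB restr_scalarM restr_scalarC.
End Restr.

Section Converse.
Variables (K : comPzRingType) (B : pzAlgType K).
(** With this structure an antimorphism to B is a morphism to the opposite algebra, so the universal
    properties produce antimorphisms as well. *)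
Let conv_scalar (k : K) : B^c := k%:S : B.
Let conv_scalarB : zmod_morphism conv_scalar.
Proof. exact: (@scalar_is_zmod_morphism K B). Qed.
Let conv_scalarM : monoid_morphism conv_scalar.
Proof.
split=> [|k l]; first exact: (rmorph1 (@Defs.scalar K B)).
by rewrite mulrC; exact: (@rmorphM _ _ (@Defs.scalar K B)).
Qed.
Let conv_scalarC k (u : B^c) : conv_scalar k * u = u * conv_scalar k.
Proof. exact/esym/(@scalarC K B). Qed.
HB.instance Definition _ :=
  hasScalars.Build K B^c conv_scalarB conv_scalarM conv_scalarC.
End Converse.

Lemma bclassM n (w w' : bword n) : (bclass w * bclass w')%g = bclass (w ++ w').
Proof. exact: bmul_class. Qed.

Section UniversalProperties.
Variable K : comPzRingType.

Lemma free_hom X (D : pzAlgType K) (g : X -> D) :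
  exists2 f : {rmorphism Defs.free K X -> D}, scalar_morph f &
    forall x, f (fgen x) = g x.
Proof.
pose phi := fun k : K => k%:S : D.
have phiB : zmod_morphism phi by apply: rmorphB.
have phiM : monoid_morphism phi by split; [apply: rmorph1|apply: rmorphM].
have phiC k d : phi k * d = d * phi k by apply: scalarC.
exists (pack_rmorphism (free_liftB g phiB phiM phiC) (free_liftM g phiB phiM phiC)).
- exact: free_lift_scalar.
- exact: free_lift_gen.
Qed.

Lemma quot_hom (B : pzAlgType K) (P : B -> Prop) (D : pzAlgType K)
    (f : {rmorphism B -> D}) : scalar_morph f -> (forall p, P p -> f p = 0) ->
  exists2 g : {rmorphism quot P -> D}, scalar_morph g & forall u, g (proj P u) = f u.
Proof.
move=> fS fP; have fB : zmod_morphism f by apply: rmorphB.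
have fM : monoid_morphism f by split; [apply: rmorph1|apply: rmorphM].
exists (pack_rmorphism (quot_liftB fB fM fP) (quot_liftM fB fM fP)).
- by move=> k; rewrite -proj_scalar -fS; exact: quot_lift_proj.
- exact: quot_lift_proj.
Qed.

Lemma groupalg_hom (G : groupType) (D : pzAlgType K) (h : G -> D) :
    h 1%g = 1 -> (forall x y, h (x * y)%g = h x * h y) ->
  exists2 f : {rmorphism groupalg K G -> D}, scalar_morph f &
    f =1 groupalg_lift h /\ forall x, f (gelt x) = h x.
Proof.
move=> h1 hM; have [[fB fM fS] fE] := groupalg_lift_morphism h1 hM.
by exists (pack_rmorphism fB fM).
Qed.

Lemma tensor_hom (L : comPzRingType) (phi : {rmorphism K -> L}) (B : pzAlgType K)
    (D : pzAlgType L) (f : {rmorphism B -> restr phi D}) : scalar_morph f ->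
  exists2 g : {rmorphism tensor phi B -> D}, scalar_morph g &
    forall b, g (tens1 phi b) = f b.
Proof.
move=> fS.
have [|||[gB gM gS] gE] := @tensor_lift_morphism _ _ phi B D f.
- exact: (rmorphB f).
- by split; [exact: (rmorph1 f)|exact: (rmorphM f)].
- exact: fS.
by exists (pack_rmorphism gB gM).
Qed.

Section Induction.
Variables (n : nat) (Q : braidalg K n -> Prop).
Hypotheses (QS : forall k : K, Q k%:S).
Hypotheses (QD : forall u v, Q u -> Q v -> Q (u + v)).
Hypotheses (QM : forall u v, Q u -> Q v -> Q (u * v)).
Hypotheses (Qs : forall i, Q (bgen K i)) (QsV : forall i, Q (bgenV K i)).

(** A group element is the class of a word, so induction on the length of the word reduces it to the
    letters, which are generators and their inverses. *)
Lemma braidalg_ind u : Q u.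
Proof.
have [v <-] := proj_surj u; elim/free_ind: v => [k|x|v w Qv Qw|v w Qv Qw].
- exact: QS.
- have [w <-] := bclass_surj x; elim: w => [|[i b] w IHw].
    by rewrite (_ : proj _ _ = 1%:S) // rmorph1; exact: gelt1.
  rewrite (_ : proj _ _ = gelt (bclass [:: (i, b)]) * gelt (bclass w)).
    apply: QM IHw; case: b; last exact: (Qs i).
    by have := QsV i; rewrite /bgenV artinV.
  by rewrite -geltM bclassM.
- by rewrite rmorphD; apply: QD.
- by rewrite rmorphM; apply: QM.
Qed.
End Induction.

Lemma tensor_ind (L : comPzRingType) (phi : {rmorphism K -> L}) (B : pzAlgType K)
    (Q : tensor phi B -> Prop) :
    (forall l : L, Q l%:S) -> (forall b, Q (tens1 phi b)) ->
    (forall u v, Q u -> Q v -> Q (u + v)) -> (forall u v, Q u -> Q v -> Q (u * v)) ->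
  forall z, Q z.
Proof.
move=> QS Qb QD QM z.
have [v <-] := proj_surj z; elim/free_ind: v => [k|x|v w Qv Qw|v w Qv Qw] //.
- exact: QS.
- exact: Qb.
- by rewrite rmorphD; apply: QD.
- by rewrite rmorphM; apply: QM.
Qed.

End UniversalProperties.

Section BraidHom.
Variables (K : comPzRingType) (n : nat) (D : pzAlgType K) (s sV : 'I_n.-1 -> D).
Hypotheses (ssV : forall i, s i * sV i = 1) (sVs : forall i, sV i * s i = 1).
Hypothesis s_artin : forall i j : 'I_n.-1, i.+1 = j :> nat ->
  s i * s j * s i = s j * s i * s j.
Hypothesis s_far : forall i j : 'I_n.-1, (i.+1 < j)%N -> s i * s j = s j * s i.

Lemma braidalg_hom : exists2 f : {rmorphism braidalg K n -> D}, scalar_morph f &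
  f =1 groupalg_lift (braid_lift s sV) /\
  forall i, f (bgen K i) = s i /\ f (bgenV K i) = sV i.
Proof.
have [||f fS [fE fg]] := @groupalg_hom K _ D (braid_lift s sV).
- exact: braid_lift1 ssV sVs s_artin s_far.
- exact: braid_liftM ssV sVs s_artin s_far.
exists f => //; split=> // i; split; rewrite fg.
- exact: braid_lift_artin ssV sVs s_artin s_far i.
- exact: braid_lift_artinV ssV sVs s_artin s_far i.
Qed.
End BraidHom.

Lemma bgenK (K : comPzRingType) n i : bgen K i * bgenV K (i : 'I_n.-1) = 1.
Proof. by rewrite /bgen /bgenV -geltM mulgV gelt1. Qed.
Lemma bgenVK (K : comPzRingType) n i : bgenV K i * bgen K (i : 'I_n.-1) = 1.
Proof. by rewrite /bgen /bgenV -geltM mulVg gelt1. Qed.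

Lemma bgen_artin (K : comPzRingType) n (i j : 'I_n.-1) : i.+1 = j :> nat ->
  bgen K i * bgen K j * bgen K i = bgen K j * bgen K i * bgen K j.
Proof.
move=> ij; rewrite /bgen -!geltM; congr gelt; rewrite /artin.
rewrite (bclassM [:: _] [:: _]) (bclassM [:: _; _]) (bclassM [:: _] [:: _]).
by rewrite (bclassM [:: _; _]); apply/bclass_eq; exact (braid_artin ij).
Qed.

Lemma bgen_far (K : comPzRingType) n (i j : 'I_n.-1) : (i.+1 < j)%N ->
  bgen K i * bgen K j = bgen K j * bgen K i.
Proof.
move=> ij; rewrite /bgen -!geltM; congr gelt; rewrite /artin.
by rewrite !(bclassM [:: _] [:: _]); apply/bclass_eq; exact (braid_far ij).
Qed.

Section HeckeHom.
Variables (n : nat) (D : pzAlgType ringR) (s sV : 'I_n.-1 -> D).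
Hypotheses (ssV : forall i, s i * sV i = 1) (sVs : forall i, sV i * s i = 1).
Hypothesis s_artin : forall i j : 'I_n.-1, i.+1 = j :> nat ->
  s i * s j * s i = s j * s i * s j.
Hypothesis s_far : forall i j : 'I_n.-1, (i.+1 < j)%N -> s i * s j = s j * s i.
Hypothesis s_cubic : forall i, (s i - aR%:S) * (s i - bR%:S) * (s i - cR%:S) = 0.

Lemma Halg_hom : exists2 f : {rmorphism Halg n -> D}, scalar_morph f &
  forall i, f (Hs i) = s i /\ f (HsV i) = sV i.
Proof.
have [f fS [_ fE]] := braidalg_hom ssV sVs s_artin s_far.
have [|g gS gE] := @quot_hom ringR _ (@Hrel n) D f fS.
  by move=> p [i]; rewrite !(rmorphM, rmorphB) !fS (fE i).1.
by exists g => // i; rewrite /Hs /HsV !gE.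
Qed.
End HeckeHom.

(** * Universal property, relations and generators of [F_n] *)

Lemma xxVA : xA * xVA = 1.
Proof.
apply/eqP; rewrite -subr_eq0 -rmorphM -(rmorph1 (proj Arel)) -rmorphB.
exact/eqP/proj_gen/Arel_x.
Qed.

Section FHom.
Variables (n : nat) (D : pzAlgType ringA) (s sV e : 'I_n.-1 -> D) (C : D).
Hypotheses (ssV : forall i, s i * sV i = 1) (sVs : forall i, sV i * s i = 1).
Hypothesis s_artin : forall i j : 'I_n.-1, i.+1 = j :> nat ->
  s i * s j * s i = s j * s i * s j.
Hypothesis s_far : forall i j : 'I_n.-1, (i.+1 < j)%N -> s i * s j = s j * s i.
Hypothesis s_cubic : forall i, (s i - aA%:S) * (s i ^+ 2 - xA%:S * s i + 1) = 0.
Hypothesis eE : forall i, e i = aA%:S * (xVA%:S * (sV i + s i) - 1).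
Hypothesis ese : forall i j, adjacent i j -> e i * s j * e i = e i + C.
Hypothesis esVe : forall i j, adjacent i j -> e i * sV j * e i = e i + C.
Hypotheses (sC : forall i, s i * C = aA%:S * C) (Cs : forall i, C * s i = aA%:S * C).

(** The polynomial standing for the inverse of s_i goes to [sV i] by [cubic_invE], and [cubic_cup]
    turns the cubic relation into s_i e_i = a e_i. *)
Lemma Falg_hom : exists2 f : {rmorphism Falg n -> D}, scalar_morph f &
  [/\ forall i, f (Fs i) = s i, forall i, f (FsV i) = sV i,
      forall i, f (Fe i) = e i & f (FC n) = C].
Proof.
pose g (v : Fvar n) := match v with F_s i => s i | F_e i => e i | F_C => C end.
have [f fS fE] := @free_hom ringA (Fvar n) D g.
have fsV i : f (aA%:S * (fgen (F_s i) ^+ 2 - (xA%:S + aA%:S) * fgen (F_s i)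
    + (1 + aA%:S * xA%:S))) = sV i.
  rewrite !expr2 !(rmorphM, rmorphD, rmorphN) rmorph1 !fS fE /= -expr2.
  apply: (cubic_invE aA2 xxVA (ssV i) (sVs i)).
  exact/(cubic_cup aA2 xxVA (ssV i) (sVs i)).
have [|h hS hE] := @quot_hom ringA _ (@Frel n) D f fS.
  move=> p [i j ij|i j ij|i|i|i|i j ij|i j ij|i|i].
  - by rewrite rmorphB !rmorphM !fE /= s_artin // subrr.
  - by rewrite rmorphB !rmorphM !fE /= s_far // subrr.
  - by rewrite !expr2 !(rmorphM, rmorphD, rmorphN) rmorph1 !fS fE /= -expr2.
  - rewrite rmorphB rmorphM rmorphB rmorphM [f (_ + fgen _)]rmorphD fsV.
    by rewrite rmorph1 !fS !fE /= eE subrr.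
  - rewrite rmorphB !rmorphM !fS !fE /= !eE -!cupE.
    by apply/eqP; rewrite subr_eq0; apply/eqP/(cubic_cup aA2 xxVA (ssV i) (sVs i)).
  - by rewrite rmorphB !rmorphM rmorphD !fE /= ese // subrr.
  - by rewrite rmorphB rmorphD 2!rmorphM fsV !fE /= esVe // subrr.
  - by rewrite rmorphB !rmorphM !fS !fE /= sC subrr.
  - by rewrite rmorphB !rmorphM !fS !fE /= Cs subrr.
exists h => //; split=> [i|i|i|].
- by rewrite /Fs hE fE.
- by rewrite /FsV hE fsV.
- by rewrite /Fe hE fE.
- by rewrite /FC hE fE.
Qed.

End FHom.

Fact F_of_braidB n : zmod_morphism (@F_of_braid n).
Proof. by have [[]] := F_of_braidP n. Qed.
Fact F_of_braidM n : monoid_morphism (@F_of_braid n).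
Proof. by have [[]] := F_of_braidP n. Qed.
HB.instance Definition _ n :=
  GRing.isZmodMorphism.Build (braidalg ringA n) (Falg n) (@F_of_braid n)
    (@F_of_braidB n).
HB.instance Definition _ n :=
  GRing.isMonoidMorphism.Build (braidalg ringA n) (Falg n) (@F_of_braid n)
    (@F_of_braidM n).

Section FRelations.
Variable n : nat.
Implicit Types i j : 'I_n.-1.
Local Notation s := (@Fs n).
Local Notation sV := (@FsV n).
Local Notation e := (@Fe n).
Local Notation C := (FC n).

Lemma F_of_braidS k : F_of_braid (k%:S : braidalg ringA n) = k%:S.
Proof. by have [[]] := F_of_braidP n. Qed.
Lemma F_of_bgen i : F_of_braid (bgen ringA i) = s i.
Proof. by have [_ ->] := F_of_braidP n. Qed.
Lemma F_of_bgenV i : F_of_braid (bgenV ringA i) = sV i.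
Proof.
apply: (@mulr_eq1_uniq _ (s i)); last exact: FsFsV.
by rewrite -F_of_bgen -rmorphM bgenVK rmorph1.
Qed.

Let Frel_eq u v : Frel (u - v) -> proj (@Frel n) u = proj (@Frel n) v.
Proof. by move=> uv; apply/proj_eq/ideal_in. Qed.

Lemma FeE i : e i = aA%:S * (xVA%:S * (sV i + s i) - 1).
Proof.
rewrite /Fe (Frel_eq (Frel_e i)) rmorphM rmorphB rmorphM rmorphD.
by rewrite rmorph1.
Qed.

Lemma Fe_cup i : e i = cup aA xVA (s i) (sV i).
Proof. by rewrite FeE cupE. Qed.

Lemma Fse i : s i * e i = aA%:S * e i.
Proof. by have := Frel_eq (Frel_se i); rewrite !rmorphM. Qed.

Lemma Fese i j : adjacent i j -> e i * s j * e i = e i + C.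
Proof. by move=> ij; have := Frel_eq (Frel_ese ij); rewrite 2!rmorphM rmorphD. Qed.

Lemma FesVe i j : adjacent i j -> e i * sV j * e i = e i + C.
Proof. by move=> ij; have := Frel_eq (Frel_esVe ij); rewrite 2!rmorphM rmorphD. Qed.

Lemma FsC i : s i * C = aA%:S * C.
Proof. by have := Frel_eq (Frel_sC i); rewrite !rmorphM. Qed.

Lemma FCs i : C * s i = aA%:S * C.
Proof. by have := Frel_eq (Frel_Cs i); rewrite !rmorphM. Qed.

Lemma FsVC i : sV i * C = aA%:S * C.
Proof. exact (inv_scalar aA2 (FsVFs i) (FsC i)). Qed.

Lemma FCsV i : C * sV i = aA%:S * C.
Proof. exact (scalar_inv aA2 (FsFsV i) (FCs i)). Qed.

Lemma adjacent_sym i j : adjacent i j -> adjacent j i.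
Proof. by case; [right|left]. Qed.

Lemma FsV_artin i j : i.+1 = j :> nat -> sV i * sV j * sV i = sV j * sV i * sV j.
Proof. by move/Fs_artin; apply: artin_inv; rewrite (FsFsV, FsVFs). Qed.

Lemma FsV_far i j : (i.+1 < j)%N -> sV i * sV j = sV j * sV i.
Proof. by move/Fs_far; apply: comm_inv; rewrite (FsFsV, FsVFs). Qed.

Lemma FsV_cubic i : (sV i - aA%:S) * (sV i ^+ 2 - xA%:S * sV i + 1) = 0.
Proof.
apply/(cubic_cup aA2 xxVA (FsVFs i) (FsFsV i)); rewrite cupC -Fe_cup.
exact (inv_scalar aA2 (FsVFs i) (Fse i)).
Qed.

Lemma Fs_pair i j : adjacent i j -> Fpair aA xVA (s i) (sV i) (s j) (sV j) C.
Proof.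
move=> ij; have ji := adjacent_sym ij.
split; rewrite -?Fe_cup ?FsFsV ?FsVFs ?FsC ?FCs ?Fse ?Fese ?FesVe //.
by case: ij => ij; [|apply/esym]; apply: Fs_artin.
Qed.

Lemma FC_ese (hn : (3 <= n)%N) : exists i j, C = e i * s j * e i - e i.
Proof.
have h1 : (1 < n.-1)%N by rewrite ltn_predRL.
exists (Ordinal (ltnW h1)), (Ordinal h1); rewrite Fese; last by left.
by rewrite addrC addKr.
Qed.

(** The s_i generate [F_n] as an algebra: s_i^-1 and e_i are polynomials in s_i, and for n >= 3
    there are two adjacent generators, from which C = e_i s_j e_i - e_i. *)
Lemma Falg_ind (Q : Falg n -> Prop) : (3 <= n)%N ->
    (forall k : ringA, Q k%:S) -> (forall i, Q (s i)) ->
    (forall u v, Q u -> Q v -> Q (u + v)) -> (forall u v, Q u -> Q v -> Q (u * v)) ->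
  forall z, Q z.
Proof.
move=> hn QS Qs QD QM.
have QZ k u : Q u -> Q (k%:S * u) by move=> Qu; exact (QM _ _ (QS k) Qu).
have QB u v : Q u -> Q v -> Q (u - v).
  have -> : - v = (-1)%:S * v by rewrite rmorphN rmorph1 mulN1r.
  by move=> Qu Qv; apply: QD => //; exact: QZ.
have Q1 : Q 1 by rewrite -(rmorph1 (@Defs.scalar ringA (Falg n))); exact: QS.
have QsV i : Q (sV i).
  rewrite FsVE expr2 mulrDl; apply/QZ/QD; last by apply: QD Q1 (QZ _ _ (QS _)).
  by apply: QB; [exact: QM|apply: QD; exact: QZ].
have Qe i : Q (e i) by rewrite FeE; apply/QZ/QB => //; apply/QZ/QD.
have QC : Q C by have [i [j ->]] := FC_ese hn; apply: QB => //; apply/QM => //; exact: QM.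
move=> z; have [v <-] := proj_surj z; elim/free_ind: v => [k|[i|i|]|v w Qv Qw|v w Qv Qw] //.
- exact: QS.
- exact: Qs.
- exact: Qe.
- by rewrite rmorphD; apply: QD.
- by rewrite rmorphM; apply: QM.
Qed.

End FRelations.

(** * The automorphism and the antiautomorphism inverting the generators *)

(** Inversion fixes e_i and C and permutes the relations of [F_n]. The maps on the braid algebra and
    on [F_n] are involutions on generators, hence bijective. *)
Lemma Falg_inverse_automorphism n : (3 <= n)%N -> exists phi : braidalg ringA n ->
  braidalg ringA n,
      [/\ alg_morphism phi, bijective phi,
          forall i : 'I_n.-1, phi (bgen ringA i) = bgenV ringA i
        & exists psi : Falg n -> Falg n,
            [/\ alg_morphism psi, bijective psi
              & forall u, psi (F_of_braid u) = F_of_braid (phi u)]].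
Proof.
move=> hn.
have [||||phi phiS [_ phiE]] :=
  @braidalg_hom ringA n _ (bgenV ringA (n := n)) (bgen ringA (n := n)).
- exact: bgenVK.
- exact: bgenK.
- by move=> i j /(bgen_artin ringA); apply: artin_inv; rewrite (bgenK, bgenVK).
- by move=> i j /(bgen_far ringA); apply: comm_inv; rewrite (bgenK, bgenVK).
have phiK : involutive phi.
  elim/braidalg_ind => [k|u v hu hv|u v hu hv|i|i].
  - by rewrite !phiS.
  - by rewrite !rmorphD hu hv.
  - by rewrite !rmorphM hu hv.
  - by rewrite (phiE i).1 (phiE i).2.
  - by rewrite (phiE i).2 (phiE i).1.
have := @Falg_hom n (Falg n) (@FsV n) (@Fs n) (@Fe n) (FC n) (@FsVFs n) (@FsFsV n)
  (@FsV_artin n) (@FsV_far n) (@FsV_cubic n).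
case=> [i|i j|i j|i|i|psi psiS [psis psisV psie psiC]].
- by rewrite FeE [FsV i + _]addrC.
- exact: FesVe.
- exact: Fese.
- exact: FsVC.
- exact: FCsV.
have psiK : involutive psi.
  apply: (@Falg_ind n (fun z => psi (psi z) = z) hn) => [k|i|u v hu hv|u v hu hv].
  - by rewrite !psiS.
  - by rewrite psis psisV.
  - by rewrite !rmorphD hu hv.
  - by rewrite !rmorphM hu hv.
exists phi; split; [exact: rmorph_alg_morphism|exact: inv_bij|by move=> i;
  rewrite (phiE i).1|].
exists psi; split; [exact: rmorph_alg_morphism|exact: inv_bij|].
elim/braidalg_ind => [k|u v hu hv|u v hu hv|i|i].
- by rewrite phiS !F_of_braidS psiS.
- by rewrite !rmorphD hu hv.
- by rewrite !rmorphM hu hv.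
- by rewrite (phiE i).1 F_of_bgen F_of_bgenV psis.
- by rewrite (phiE i).2 F_of_bgen F_of_bgenV psisV.
Qed.

Lemma rmorph_alg_antimorphism (K : comPzRingType) (B D : pzAlgType K)
    (f : {rmorphism B -> D^c}) : scalar_morph f -> @alg_antimorphism K B D f.
Proof.
move=> fS; split=> //; [exact: (rmorphB f)|exact: (rmorph1 f)|].
by move=> u v; exact: (rmorphM f).
Qed.

(** The same construction with the opposite algebra as target. The words s_i s_j s_i and e_i s_j e_i
    are palindromes, and reversal exchanges the two relations between s_i and C. *)
Lemma Falg_inverse_antiautomorphism n : (3 <= n)%N -> exists phi : braidalg ringA n ->
  braidalg ringA n,
      [/\ alg_antimorphism phi, bijective phi,
          forall i : 'I_n.-1, phi (bgen ringA i) = bgenV ringA i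
        & exists psi : Falg n -> Falg n,
            [/\ alg_antimorphism psi, bijective psi
              & forall u, psi (F_of_braid u) = F_of_braid (phi u)]].
Proof.
move=> hn.
have br (i j : 'I_n.-1) : i.+1 = j :> nat -> bgenV ringA i * bgenV ringA j * bgenV ringA i =
    bgenV ringA j * bgenV ringA i * bgenV ringA j.
  by move/(bgen_artin ringA); apply: artin_inv; rewrite (bgenK, bgenVK).
have far (i j : 'I_n.-1) : (i.+1 < j)%N ->
    bgenV ringA i * bgenV ringA j = bgenV ringA j * bgenV ringA i.
  by move/(bgen_far ringA); apply: comm_inv; rewrite (bgenK, bgenVK).
have := @braidalg_hom ringA n (braidalg ringA n)^c (bgenV ringA (n := n))
  (bgen ringA (n := n))
  (@bgenK ringA n) (@bgenVK ringA n).
case=> [i j ij|i j ij|phi phiS [_ phiE]].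
- by have h := br i j ij; rewrite -!mulrA in h; exact: h.
- exact: (esym (far i j ij)).
(* Retyped with values in the algebra itself, so that products below are not those of the opposite
   algebra. *)
pose phi' : braidalg ringA n -> braidalg ringA n := phi.
have phiM u v : phi' (u * v) = phi' v * phi' u by exact (rmorphM phi u v).
have phiD u v : phi' (u + v) = phi' u + phi' v by exact (rmorphD phi u v).
have phiK : involutive phi'.
  elim/braidalg_ind => [k|u v hu hv|u v hu hv|i|i].
  - by rewrite /phi' !phiS.
  - by rewrite !phiD hu hv.
  - by rewrite !phiM hu hv.
  - by rewrite /phi' ?/psi' (phiE i).1 (phiE i).2.
  - by rewrite /phi' ?/psi' (phiE i).2 (phiE i).1.
have := @Falg_hom n (Falg n)^c (@FsV n) (@Fs n) (@Fe n) (FC n) (@FsFsV n) (@FsVFs n).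
case=> [i j ij|i j ij|i|i|i j ij|i j ij|i|i|psi psiS [psis psisV psie psiC]].
- by have h := FsV_artin ij; rewrite -!mulrA in h; exact: h.
- exact: (esym (FsV_far ij)).
(* The cubic relation read backwards; its two factors commute. *)
- have h : (FsV i ^+ 2 - FsV i * xA%:S + 1) * (FsV i - aA%:S) = 0.
    rewrite -scalarC -[RHS](FsV_cubic i); set p := _ + 1.
    suff cp : FsV i * p = p * FsV i by rewrite mulrBl mulrBr cp scalarC.
    by rewrite /p mulrDl mulrDr mulrBl mulrBr mulr_scalar expr2 -!mulrA mul1r mulr1.
  exact: h.
- have h : Fe i = ((FsV i + Fs i) * xVA%:S - 1) * aA%:S.
    by rewrite -!scalarC FeE.
  by rewrite h [FsV i + _]addrC.
- by have h := FesVe ij; rewrite -!mulrA in h; exact: h.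
- by have h := Fese ij; rewrite -!mulrA in h; exact: h.
- by have h := FCsV i; rewrite scalarC in h; exact: h.
- by have h := FsVC i; rewrite scalarC in h; exact: h.
pose psi' : Falg n -> Falg n := psi.
have psiM u v : psi' (u * v) = psi' v * psi' u by exact (rmorphM psi u v).
have psiD u v : psi' (u + v) = psi' u + psi' v by exact (rmorphD psi u v).
have psiK : involutive psi'.
  apply: (@Falg_ind n (fun z => psi' (psi' z) = z) hn) => [k|i|u v hu hv|u v hu hv].
  - by rewrite /psi' !psiS.
  - by rewrite /psi' psis psisV.
  - by rewrite !psiD hu hv.
  - by rewrite !psiM hu hv.
exists phi'; split; [exact: rmorph_alg_antimorphism|exact: inv_bij|by move=> i;
  rewrite /phi' ?/psi' (phiE i).1|].
exists psi'; split; [exact: rmorph_alg_antimorphism|exact: inv_bij|].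
elim/braidalg_ind => [k|u v hu hv|u v hu hv|i|i].
- by rewrite /phi' /psi' phiS !F_of_braidS psiS.
- by rewrite rmorphD psiD phiD rmorphD hu hv.
- by rewrite rmorphM psiM phiM rmorphM hu hv.
- by rewrite /phi' ?/psi' (phiE i).1 F_of_bgen F_of_bgenV psis.
- by rewrite /phi' ?/psi' (phiE i).2 F_of_bgen F_of_bgenV psisV.
Qed.

(** * Specialised base rings, Hecke relations and extensions of scalars of [F_n] *)

Lemma R_Sdd_y : R_Sdd yR = 1.
Proof.
apply/eqP; rewrite -subr_eq0 -(rmorph1 S_Sdd) /= -rmorphB.
exact/eqP/proj_gen/Sdd_rel_y.
Qed.

Lemma R_Sdd_xxV : R_Sdd xR * S_Sdd xVS = 1.
Proof. by rewrite /= -rmorphM [R_S _ * _]loc_invP rmorph1. Qed.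

Lemma A_Sdd_xV : A_Sdd xVA = S_Sdd xVS.
Proof.
apply: (@mulr_eq1_uniq _ (R_Sdd xR)); last exact: R_Sdd_xxV.
by rewrite -A_Sdd_x mulrC -rmorphM xxVA rmorph1.
Qed.

Lemma Sddpm_a e : Sdd_Sddpm e (R_Sdd aR) = (-1) ^+ e.
Proof.
apply/eqP; rewrite -subr_eq0 -(rmorph_sign (Sdd_Sddpm e)) -rmorphB.
exact/eqP/proj_gen/Sddpm_rel_a.
Qed.

Lemma Spm_Sddpm_R e r : Spm_Sddpm e (R_Spm e r) = Sdd_Sddpm e (R_Sdd r).
Proof. exact: Spm_Sddpm_S. Qed.

Lemma quad_factor (K : comPzRingType) (B : pzAlgType K) (u : B) (b c : K) :
  (u - b%:S) * (u - c%:S) = u ^+ 2 - (b + c)%:S * u + (b * c)%:S.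
Proof.
rewrite mulrBl !mulrBr -rmorphM -scalarC opprB expr2 rmorphD mulrDl opprD !addrA.
by rewrite [LHS](ACl (1*2*4*3)) [RHS](ACl (1*3*2*4)).
Qed.

Section HeckeRelations.
Variable n : nat.
Implicit Types i j : 'I_n.-1.

Lemma HsK i : Hs i * HsV i = 1.
Proof.
by have := congr1 (proj (@Hrel n)) (bgenK ringR i); rewrite rmorphM rmorph1.
Qed.
Lemma HsVK i : HsV i * Hs i = 1.
Proof.
by have := congr1 (proj (@Hrel n)) (bgenVK ringR i); rewrite rmorphM rmorph1.
Qed.
Lemma Hs_artin i j : i.+1 = j :> nat -> Hs i * Hs j * Hs i = Hs j * Hs i * Hs j.
Proof. by move=> ij; have := congr1 (proj (@Hrel n)) (bgen_artin ringR ij);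
  rewrite !rmorphM. Qed.
Lemma Hs_far i j : (i.+1 < j)%N -> Hs i * Hs j = Hs j * Hs i.
Proof. by move=> ij; have := congr1 (proj (@Hrel n)) (bgen_far ringR ij);
  rewrite !rmorphM. Qed.
Lemma Hs_cubic i : (Hs i - aR%:S) * (Hs i - bR%:S) * (Hs i - cR%:S) = 0.
Proof. by have := proj_gen (Hrel_cubic i); rewrite !(rmorphM, rmorphB). Qed.

Lemma Halg_ind (Q : Halg n -> Prop) :
    (forall k : ringR, Q k%:S) -> (forall i, Q (Hs i)) -> (forall i, Q (HsV i)) ->
    (forall u v, Q u -> Q v -> Q (u + v)) -> (forall u v, Q u -> Q v -> Q (u * v)) ->
  forall z, Q z.
Proof.
move=> QS Qs QsV QD QM z; have [v <-] := proj_surj z.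
elim/braidalg_ind: v => [k|u v hu hv|u v hu hv|i|i].
- exact: QS.
- by rewrite (rmorphD (proj (@Hrel n)) u v); exact: QD.
- by rewrite (rmorphM (proj (@Hrel n)) u v); exact: QM.
- exact: Qs.
- exact: QsV.
Qed.

End HeckeRelations.

Lemma tens1_cubic (K L : comPzRingType) (phi : {rmorphism K -> L}) (B : pzAlgType K)
    (u : B) (a x : K) : (u - a%:S) * (u ^+ 2 - x%:S * u + 1) = 0 ->
  (tens1 phi u - (phi a)%:S) * (tens1 phi u ^+ 2 - (phi x)%:S * tens1 phi u + 1) = 0.
Proof.
move=> /(congr1 (tens1 phi)); rewrite rmorph0 rmorphM rmorphB rmorphD rmorphB.
by rewrite rmorphXn rmorphM rmorph1 /= !tens1_scalar.
Qed.

Lemma tens1_scale (K L : comPzRingType) (phi : {rmorphism K -> L}) (B : pzAlgType K)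
  (k : K) (u : B) : tens1 phi (k%:S * u) = (phi k)%:S * tens1 phi u.
Proof. by rewrite rmorphM /= tens1_scalar. Qed.

Section TensorF.
Variables (n : nat) (L : comPzRingType) (phi : {rmorphism ringA -> L}).
Local Notation T := (tensor phi (Falg n)).
Local Notation j := (tens1 phi : Falg n -> T).

Lemma tensor_F_ind (Q : T -> Prop) : (3 <= n)%N ->
    (forall l : L, Q l%:S) -> (forall i, Q (j (Fs i))) ->
    (forall u v, Q u -> Q v -> Q (u + v)) -> (forall u v, Q u -> Q v -> Q (u * v)) ->
  forall z, Q z.
Proof.
move=> hn QS Qs QD QM; apply: tensor_ind => // z.
apply: (@Falg_ind n (fun z => Q (j z)) hn) => // [k|u v hu hv|u v hu hv].
- by rewrite tens1_scalar.
- by rewrite rmorphD; apply: QD.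
- by rewrite rmorphM; apply: QM.
Qed.

(** Where y = b c becomes 1, the factors for b and c multiply to u^2 - x u + 1, which gives the
    cubic relation of [F_n]. *)
Lemma tensor_cubic (rho : {rmorphism ringR -> L}) : rho aR = phi aA ->
    rho xR = phi xA -> rho yR = 1 -> forall i : 'I_n.-1,
  (j (Fs i) - (rho aR)%:S) * (j (Fs i) - (rho bR)%:S) * (j (Fs i) - (rho cR)%:S) = 0.
Proof.
move=> ra rx ry i; rewrite -mulrA quad_factor.
have -> : rho bR + rho cR = phi xA by rewrite -rmorphD.
have -> : rho bR * rho cR = 1 by rewrite -rmorphM.
rewrite ra rmorph1; exact (tens1_cubic phi (Fs_cubic i)).
Qed.

(** Each s_i multiplies C by a on either side, hence every element acts on C by a scalar. This is
    why the two-sided ideal of C is no larger than its span ([ideal_C]). *)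
Lemma tensor_mulC (w : T) : (3 <= n)%N -> exists2 k : L,
  w * j (FC n) = k%:S * j (FC n) & j (FC n) * w = k%:S * j (FC n).
Proof.
move=> hn; elim/tensor_F_ind: w =>
  [//|l|i|u v [k hk hk'] [l hl hl']|u v [k hk hk'] [l hl hl']].
- by exists l => //; rewrite scalarC.
- have e1 := congr1 (tens1 phi) (FsC i); have e2 := congr1 (tens1 phi) (FCs i).
  by exists (phi aA); rewrite -(tens1_scale phi); [rewrite -e1|rewrite -e2];
    rewrite rmorphM.
- by exists (k + l); rewrite rmorphD ?mulrDr !mulrDl ?hk ?hl ?hk' ?hl'.
- exists (k * l).
    by rewrite -mulrA hl mulr_scalar hk scalar_mulA mulrC.
  by rewrite mulrA hk' -mulrA hl' scalar_mulA.
Qed.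

Lemma ideal_C z : (3 <= n)%N -> ideal_gen (fun z => z = j (FC n)) z ->
  exists k : L, z = k%:S * j (FC n).
Proof.
move=> hn; elim=> {z} [z ->||u v _ [k ->] _ [l ->]|w u _ [k ->]|w u _ [k ->]].
- by exists 1; rewrite rmorph1 mul1r.
- by exists 0; rewrite rmorph0 mul0r.
- by exists (k + l); rewrite rmorphD mulrDl.
- have [l hl _] := tensor_mulC w hn; exists (k * l).
  by rewrite mulr_scalar hl scalar_mulA.
- have [l _ hl] := tensor_mulC w hn; exists (k * l).
  by rewrite -mulrA hl scalar_mulA.
Qed.

End TensorF.

(** * The morphisms from the Hecke algebra and from its quotient by the R_i *)

(** At y = 1 the element R_i takes the form treated in [BMWt_rel0]. The vanishing is proved in B'
    and carried to D by j. *)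
Lemma BMWt_transfer (B B' D : pzRingType) (h : {rmorphism B -> D})
    (j : {rmorphism B' -> D}) (x y s sV t tV : B) (x' s' sV' t' tV' : B') :
    h s = j s' -> h sV = j sV' -> h t = j t' -> h tV = j tV' -> h y = 1 -> h x = j x' ->
    - (s' * tV' * s') + tV' * s' * tV' - s' * t' * s' - x' * (tV' * tV')
      + x' * (s' * s') + tV' * sV' * tV' = 0 ->
  h (- y * s * tV * s + y ^+ 2 * tV * s * tV - s * t * s - x * y ^+ 2 * tV ^+ 2
     + x * s ^+ 2 + y ^+ 3 * tV * sV * tV) = 0.
Proof.
move=> hs hsV ht htV hy hx /(congr1 j); rewrite rmorph0 => <-.
rewrite !exprS expr0 !mulr1 !(rmorphD, rmorphN, rmorphM) hy hs hsV ht htV hx.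
by rewrite !(mul1r, mulr1, mulN1r, mulNr) !mulrA.
Qed.

Lemma tensor_map_hom (K L : comPzRingType) (phi : {rmorphism K -> L})
    (B D : pzAlgType K) (f : {rmorphism B -> D}) : scalar_morph f ->
  exists2 m : {rmorphism tensor phi B -> tensor phi D}, scalar_morph m &
    m =1 tensor_map phi f /\ forall b, m (tens1 phi b) = tens1 phi (f b).
Proof.
move=> fS; have [|||[mB mM mS] mE] := @tensor_lift_morphism _ _ phi B
  (tensor phi D) (fun b => tens1 phi (f b)).
- by move=> u v; rewrite !rmorphB.
- by split=> [|u v]; rewrite ?rmorph1 ?rmorphM.
- by move=> k; rewrite fS tens1_scalar.
by exists (pack_rmorphism mB mM).
Qed.

Lemma Falg_Hecke_quotient n : (3 <= n)%N ->
    exists f : tensor R_Sdd (Halg n) -> tensor A_Sdd (Falg n),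
      [/\ alg_morphism f, surjective f,
          forall i : 'I_n.-1, f (tens1 R_Sdd (Hs i)) = tens1 A_Sdd (Fs i)
        & exists2 g : tensor R_Sdd (BMWtalg n) -> tensor A_Sdd (Falg n),
            alg_morphism g &
            forall z, f z = g (tensor_map R_Sdd (proj (@BMWt_rel n)) z)].
Proof.
move=> hn; pose T := tensor A_Sdd (Falg n).
pose j : {rmorphism Falg n -> T} := tens1 A_Sdd.
have [|||||h hS hE] := @Halg_hom n (restr R_Sdd T) (fun i => j (Fs i)) (fun i => j (FsV i)).
- by move=> i; have := rmorphM j (Fs i) (FsV i); rewrite FsFsV rmorph1.
- by move=> i; have := rmorphM j (FsV i) (Fs i); rewrite FsVFs rmorph1.
- by move=> i k ik; have := congr1 j (Fs_artin ik); rewrite !rmorphM.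
- by move=> i k ik; have := congr1 j (Fs_far ik); rewrite !rmorphM.
- by move=> i; exact (tensor_cubic (esym A_Sdd_a) (esym A_Sdd_x) R_Sdd_y i).
have [f fS fE] := tensor_hom hS.
have [h' h'S h'E] : exists2 h' : {rmorphism BMWtalg n -> restr R_Sdd T},
    scalar_morph h' & forall u, h' (proj (@BMWt_rel n) u) = h u.
  apply: quot_hom => //.
  move=> _ [i k ik].
  (* R_i vanishes already in [F_n], over A; only its coefficients x and y live over R. *)
  apply: (BMWt_transfer (j := j) (hE i).1 (hE i).2 (hE k).1 (hE k).2).
  - by rewrite hS; exact (congr1 (@Defs.scalar _ T) R_Sdd_y).
  - rewrite hS; apply: etrans (congr1 (@Defs.scalar _ T) (esym A_Sdd_x)) (esym _).
    exact: (@tens1_scalar _ _ A_Sdd (Falg n) xA).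
  - by apply: (BMWt_rel0 aA2 xxVA); apply: Fs_pair; left.
have [g gS gE] := tensor_hom h'S.
exists f; split.
- exact: rmorph_alg_morphism.
- apply: tensor_F_ind => // [l|i|_ _ [u <-] [v <-]|_ _ [u <-] [v <-]].
  + exists l%:S; exact: fS.
  + by exists (tens1 R_Sdd (Hs i)); rewrite fE (hE i).1.
  + by exists (u + v); rewrite rmorphD.
  + by exists (u * v); rewrite rmorphM.
- by move=> i; rewrite fE (hE i).1.
exists g; first exact: rmorph_alg_morphism.
have [|m mS [mm mE]] := @tensor_map_hom _ _ R_Sdd (Halg n) (BMWtalg n) (proj (@BMWt_rel n)).
  by [].
move=> z; rewrite -mm.
elim/tensor_ind: z => [l|b|u v hu hv|u v hu hv].
- by rewrite fS [m _]mS gS.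
- by rewrite fE [m _]mE gE h'E.
- by rewrite !rmorphD hu hv.
- by rewrite !rmorphM hu hv.
Qed.

(** * Transport of the BMW relations by braid conjugation *)

Section AdjacentConjugation.
Variables (K : comPzRingType) (B : pzAlgType K) (a xV : K) (n : nat).
Variables (s sV : 'I_n.-1 -> B).
Hypotheses (ssV : forall i, s i * sV i = 1) (sVs : forall i, sV i * s i = 1).
Hypothesis s_artin : forall i j : 'I_n.-1, i.+1 = j :> nat ->
  s i * s j * s i = s j * s i * s j.
Hypothesis s_far : forall i j : 'I_n.-1, (i.+1 < j)%N -> s i * s j = s j * s i.
Local Notation e i := (cup a xV (s i) (sV i)).

Definition cup_rel (i j : 'I_n.-1) :=
  e i * s j * e i = e i /\ e i * sV j * e i = e i.

(** An element intertwining generators also intertwines their inverses and their cups. The relation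
    is thus carried over up to a right factor w, which wV cancels. *)
Lemma cup_rel_conj (w wV : B) i j k l : w * wV = 1 ->
  w * s i = s k * w -> w * s j = s l * w -> cup_rel i j -> cup_rel k l.
Proof.
move=> wwV wi wj [h hV].
have we : w * e i = e k * w by apply: conj_cup.
have wjV : w * sV j = sV l * w by apply: conj_inv.
have cancel (u v : B) : u * w = v * w -> u = v.
  by move=> uv; rewrite -[u]mulr1 -[v]mulr1 -wwV !mulrA uv.
split; apply: cancel; rewrite -[_ * e k * w]mulrA -we.
  by rewrite -[in RHS]h !mulrA we -[e k * w * _]mulrA wj !mulrA.
by rewrite -[in RHS]hV !mulrA we -[e k * w * _]mulrA wjV !mulrA.
Qed.

(** Conjugation by s_i s_j s_i exchanges s_i and s_j. *)
Lemma cup_rel_sym (i j : 'I_n.-1) : i.+1 = j :> nat -> cup_rel i j -> cup_rel j i.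
Proof.
move=> /s_artin ij; apply: (@cup_rel_conj (s i * s j * s i) (sV i * sV j * sV i)).
- rewrite -!mulrA [s i * (sV i * _)]mulrA ssV mul1r [s j * _]mulrA ssV mul1r.
  by rewrite ssV.
- by rewrite {1}ij !mulrA.
- by rewrite {2}ij !mulrA.
Qed.

(** Conjugation by s_i s_j s_k sends s_i to s_j and s_j to s_k. *)
Lemma cup_rel_shift (i j k : 'I_n.-1) : i.+1 = j :> nat -> j.+1 = k :> nat ->
  cup_rel i j -> cup_rel j k.
Proof.
move=> ij jk; have far : s i * s k = s k * s i by apply: s_far; rewrite ij jk.
apply: (@cup_rel_conj (s i * s j * s k) (sV k * sV j * sV i)).
- rewrite -!mulrA [s k * (sV k * _)]mulrA ssV mul1r [s j * _]mulrA ssV mul1r.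
  by rewrite ssV.
- by rewrite -mulrA -far mulrA (s_artin ij) !mulrA.
- by rewrite -!mulrA [s j * (s k * s j)]mulrA (s_artin jk) !mulrA far.
Qed.

Lemma cup_rel_adjacent : (forall i j : 'I_n.-1, i = 0%N :> nat -> j = 1%N :> nat ->
    cup_rel i j) -> forall i j, adjacent i j -> cup_rel i j.
Proof.
move=> h; have hS m : forall i j : 'I_n.-1, i = m :> nat -> j = m.+1 :> nat -> cup_rel i j.
  elim: m => [|m IH] i j im jm; first exact: h.
  have mn : (m < n.-1)%N by rewrite (ltn_trans _ (ltn_ord i)) // im.
  by apply: (@cup_rel_shift (Ordinal mn)); rewrite /= ?im ?jm //; apply: IH.
move=> i j [ij|ji]; first exact: (hS i).
by apply: cup_rel_sym => //; apply: (hS j).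
Qed.

End AdjacentConjugation.

(** When a specialises to the sign +-1, the formula (a s^-1 +- s) / x -+ 1 is this sign times (s^-1
    + s) / x - 1, which is the formula for e_i in [F_n]. *)
Lemma cup_image (K L : comPzRingType) (psi : {rmorphism K -> L}) (B : pzAlgType K)
    (D : pzAlgType L) (J : {rmorphism B -> D}) (sg : bool) (k r : K) (u v : B) :
    (forall k, J k%:S = (psi k)%:S) -> psi r = (-1) ^+ sg ->
  J (k%:S * (r%:S * u + (-1) ^+ sg * v) - (-1) ^+ sg) =
  ((-1) ^+ sg)%:S * ((psi k)%:S * (J u + J v) - 1).
Proof.
move=> JS hr; rewrite rmorphB rmorphM rmorphD !rmorphM !JS hr !rmorph_sign.
by rewrite -mulrDr mulrBr mulr1; congr (_ - _); rewrite !mulrA; case: sg {hr};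
   rewrite /= ?expr1 ?expr0 ?mulN1r ?mulrN1 ?mul1r ?mulr1.
Qed.

Lemma tensor_F_hom (n : nat) (L : comPzRingType) (phi : {rmorphism ringA -> L})
    (D : pzAlgType L) (s sV e : 'I_n.-1 -> D) (C : D) :
    (forall i, s i * sV i = 1) -> (forall i, sV i * s i = 1) ->
    (forall i j : 'I_n.-1, i.+1 = j :> nat -> s i * s j * s i = s j * s i * s j) ->
    (forall i j : 'I_n.-1, (i.+1 < j)%N -> s i * s j = s j * s i) ->
    (forall i, (s i - (phi aA)%:S) * (s i ^+ 2 - (phi xA)%:S * s i + 1) = 0) ->
    (forall i, e i = (phi aA)%:S * ((phi xVA)%:S * (sV i + s i) - 1)) ->
    (forall i j, adjacent i j -> e i * s j * e i = e i + C) ->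
    (forall i j, adjacent i j -> e i * sV j * e i = e i + C) ->
    (forall i, s i * C = (phi aA)%:S * C) -> (forall i, C * s i = (phi aA)%:S * C) ->
  exists2 f : {rmorphism tensor phi (Falg n) -> D}, scalar_morph f &
  [/\ forall i, f (tens1 phi (Fs i)) = s i, forall i, f (tens1 phi (FsV i)) = sV i,
      forall i, f (tens1 phi (Fe i)) = e i & f (tens1 phi (FC n)) = C].
Proof.
move=> ssV sVs artin far cub eE ese esVe sC Cs.
have [h hS [hs hsV he hC]] :=
  @Falg_hom n (restr phi D) s sV e C ssV sVs artin far cub eE ese esVe sC Cs.
have [f fS fE] := @tensor_hom _ _ phi (Falg n) D h hS.
by exists f => //; split=> *; rewrite fE.
Qed.

(** * Comparison of [F_n] with the BMW algebra over a ring L in which a = +-1 and y = 1 *)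

Section TensorHecke.
Variables (n : nat) (sg : bool) (L : comPzRingType).
Variables (phi : {rmorphism ringA -> L}) (psi : {rmorphism ringSpm sg -> L}).
Local Notation rho r := (psi (R_Spm sg r)).
Hypotheses (phi_a : phi aA = (-1) ^+ sg) (rho_a : rho aR = (-1) ^+ sg).
Hypotheses (rho_x : rho xR = phi xA) (rho_y : rho yR = 1).
Hypothesis psi_xV : psi (S_Spm sg xVS) = phi xVA.
Implicit Types i j : 'I_n.-1.

Section ToBMW.
Variables (D : pzAlgType L) (J : {rmorphism HSpm n sg -> D}).
Hypothesis JS : forall k, J k%:S = (psi k)%:S.
Hypothesis J0 : forall p, BMWpm_rel p -> J p = 0.

Variable q : {rmorphism Halg n -> D}.
Hypothesis qE : forall u, q u = J (tens1 (R_Spm sg) u).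

Lemma q_scalar r : q r%:S = (rho r)%:S.
Proof. by rewrite qE -JS; congr (J _); exact: (@tens1_scalar _ _ _ (Halg n)). Qed.

Lemma q_cubic i : (q (Hs i) - (phi aA)%:S) *
  (q (Hs i) ^+ 2 - (phi xA)%:S * q (Hs i) + 1) = 0.
Proof.
have := congr1 q (Hs_cubic i).
rewrite rmorph0 2!rmorphM 3!rmorphB 3!q_scalar -mulrA quad_factor => <-.
rewrite rho_a phi_a -rho_x; congr (_ * (_ - _%:S * _ + _)).
  by rewrite /xR !rmorphD.
by rewrite -(rmorph1 (@Defs.scalar L D)) -rho_y /yR !rmorphM.
Qed.

(** The BMW algebra imposes its relations on the first two generators only; [cup_rel_adjacent]
    spreads them to all adjacent pairs, which are the relations of [F_n] with C = 0. *)
Lemma tensor_F_to_BMW : exists2 f : {rmorphism tensor phi (Falg n) -> D}, scalar_morph f &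
  [/\ forall i, f (tens1 phi (Fs i)) = q (Hs i),
      forall i, f (tens1 phi (FsV i)) = q (HsV i),
      forall i, f (tens1 phi (Fe i)) = J (HSpm_e sg i)
    & f (tens1 phi (FC n)) = 0].
Proof.
pose s i := q (Hs i); pose sV i := q (HsV i).
pose e i := J (HSpm_e sg i).
have ssV i : s i * sV i = 1 by rewrite -rmorphM HsK rmorph1.
have sVs i : sV i * s i = 1 by rewrite -rmorphM HsVK rmorph1.
have artin i j : i.+1 = j :> nat -> s i * s j * s i = s j * s i * s j.
  by move=> /Hs_artin/(congr1 q); rewrite 4!rmorphM.
have far i j : (i.+1 < j)%N -> s i * s j = s j * s i.
  by move=> /Hs_far/(congr1 q); rewrite 2!rmorphM.
have eE i : e i = cup (phi aA) (phi xVA) (s i) (sV i).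
  rewrite cupE phi_a -psi_xV.
  rewrite /s /sV !qE.
  exact (@cup_image _ _ psi (HSpm n sg) D J sg _ _ _ _ JS rho_a).
have ese i j : adjacent i j -> e i * s j * e i = e i /\ e i * sV j * e i = e i.
  rewrite !eE; move: i j; apply: cup_rel_adjacent => // i j i0 j1.
  rewrite /cup_rel -!eE; split; apply/eqP; rewrite -subr_eq0; apply/eqP.
    by have := J0 (BMWpm_ese sg i0 j1); rewrite rmorphB 2!rmorphM -qE.
  by have := J0 (BMWpm_esVe sg i0 j1); rewrite rmorphB 2!rmorphM -qE.
have := @tensor_F_hom n L phi D s sV e 0 ssV sVs artin far q_cubic.
case=> [i|i j ij|i j ij|i|i|f fS [fs fsV fe fC]].
- by rewrite eE cupE.
- by rewrite addr0; case: (ese i j ij).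
- by rewrite addr0; case: (ese i j ij).
- by rewrite !mulr0.
- by rewrite mul0r mulr0.
by exists f.
Qed.

End ToBMW.

Section ToF.
Variables (D : pzAlgType L) (p : {rmorphism Falg n -> D}).
Hypothesis pS : forall k, p k%:S = (phi k)%:S.
Hypothesis pC : p (FC n) = 0.

Lemma p_cubic i :
  (p (Fs i) - (rho aR)%:S) * (p (Fs i) - (rho bR)%:S) * (p (Fs i) - (rho cR)%:S) = 0.
Proof.
rewrite -mulrA quad_factor rho_a -phi_a.
have -> : rho bR + rho cR = phi xA by rewrite -rho_x /xR !rmorphD.
have -> : rho bR * rho cR = 1 by rewrite -rho_y /yR !rmorphM.
have := congr1 p (Fs_cubic i); rewrite rmorph0 rmorphM rmorphB rmorphD rmorphB.
by rewrite rmorphXn rmorphM !rmorph1 !pS.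
Qed.

Lemma p_e i : p (Fe i) = ((-1) ^+ sg)%:S *
  ((psi (S_Spm sg xVS))%:S * (p (FsV i) + p (Fs i)) - 1).
Proof. by rewrite FeE rmorphM rmorphB rmorphM rmorphD rmorph1 !pS phi_a psi_xV. Qed.

(** Once C is killed, the BMW relations are instances of those of [F_n]. The map is built along the
    construction of its source: Hecke algebra, extension of scalars, quotient, extension to L. *)
Lemma BMW_to_tensor_F : exists2 g : {rmorphism tensor psi (BMWpm n sg) -> D},
  scalar_morph g & forall i, g (tens1 psi (BMWpm_s sg i)) = p (Fs i).
Proof.
pose D1 : pzAlgType (ringSpm sg) := restr psi D.
pose s i := p (Fs i); pose sV i := p (FsV i).
have ssV i : s i * sV i = 1 by rewrite -rmorphM FsFsV rmorph1.
have sVs i : sV i * s i = 1 by rewrite -rmorphM FsVFs rmorph1.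
have artin i j : i.+1 = j :> nat -> s i * s j * s i = s j * s i * s j.
  by move=> /Fs_artin/(congr1 p); rewrite 4!rmorphM.
have far i j : (i.+1 < j)%N -> s i * s j = s j * s i.
  by move=> /Fs_far/(congr1 p); rewrite 2!rmorphM.
have [h hS hE] := @Halg_hom n (restr (R_Spm sg) D1) s sV ssV sVs artin far p_cubic.
have [h2 h2S h2E] := @tensor_hom _ _ (R_Spm sg) (Halg n) D1 h hS.
have h2s i : h2 (HSpm_s sg i) = p (Fs i) by exact (etrans (h2E _) (hE i).1).
have h2sV i : h2 (HSpm_sV sg i) = p (FsV i) by exact (etrans (h2E _) (hE i).2).
have h2e i : h2 (HSpm_e sg i) = p (Fe i).
  rewrite p_e -h2s -h2sV.
  exact (@cup_image _ _ psi (HSpm n sg) D h2 sg _ _ _ _ h2S rho_a).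
have [|h3 h3S h3E] := @quot_hom _ (HSpm n sg) (@BMWpm_rel n sg) D1 h2 h2S.
  move=> _ [i j i0 j1|i j i0 j1]; have ij : adjacent i j by left; rewrite i0 j1.
    have := congr1 p (Fese ij); rewrite 2!rmorphM rmorphD pC addr0.
    by rewrite -h2s -h2e -2![in LHS]rmorphM => e; rewrite rmorphB e subrr.
  have := congr1 p (FesVe ij); rewrite 2!rmorphM rmorphD pC addr0.
  by rewrite -h2sV -h2e -2![in LHS]rmorphM => e; rewrite rmorphB e subrr.
have [g gS gE] := @tensor_hom _ _ psi (BMWpm n sg) D h3 h3S.
by exists g => // i; rewrite gE; apply: (etrans (h3E _) (h2s i)).
Qed.

End ToF.


Local Notation T := (tensor phi (Falg n)).
Local Notation T' := (tensor psi (BMWpm n sg)).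

Lemma tensor_BMW_ind (Q : T' -> Prop) : (forall l : L, Q l%:S) ->
    (forall i, Q (tens1 psi (proj (@BMWpm_rel n sg) (HSpm_s sg i)))) ->
    (forall i, Q (tens1 psi (proj (@BMWpm_rel n sg) (HSpm_sV sg i)))) ->
    (forall u v, Q u -> Q v -> Q (u + v)) -> (forall u v, Q u -> Q v -> Q (u * v)) ->
  forall z, Q z.
Proof.
pose pr := proj (@BMWpm_rel n sg) => QS Qs QsV QD QM.
(* The composite is replaced by a single morphism with its defining equation, so that it is
   rewritten as one map. *)
have [J JE] : exists J : {rmorphism HSpm n sg -> T'}, forall u, J u = tens1 psi (pr u).
  by exists (tens1 psi \o pr).
have [q qE] : exists q : {rmorphism Halg n -> T'}, forall u, q u = J (tens1 (R_Spm sg) u).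
  by exists (J \o tens1 (R_Spm sg)).
have QJ k : Q (J k%:S) by rewrite JE [tens1 _ _](@tens1_scalar _ _ psi (BMWpm n sg)).
apply: tensor_ind => // b; have [u <-] := proj_surj b; rewrite -JE.
elim/tensor_ind: u => [//|z|u v hu hv|u v hu hv].
- rewrite -qE; elim/Halg_ind: z => [k|i|i|u v hu hv|u v hu hv].
  + by rewrite qE [tens1 _ _](@tens1_scalar _ _ _ (Halg n)).
  + by rewrite qE JE; exact: Qs.
  + by rewrite qE JE; exact: QsV.
  + by rewrite rmorphD; apply: QD.
  + by rewrite rmorphM; apply: QM.
- by rewrite rmorphD; apply: QD.
- by rewrite rmorphM; apply: QM.
Qed.

Lemma tensor_F_BMW : (3 <= n)%N -> exists f : T -> T',
  [/\ alg_morphism f /\ surjective f,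
      forall i, f (tens1 phi (Fs i)) = tens1 psi (BMWpm_s sg i),
      forall i, f (tens1 phi (Fe i)) = tens1 psi (BMWpm_e sg i),
      f (tens1 phi (FC n)) = 0
    & forall z, f z = 0 <-> exists k : L, z = k%:S * tens1 phi (FC n)].
Proof.
move=> hn; pose pr := proj (@BMWpm_rel n sg).
have [J JE] : exists J : {rmorphism HSpm n sg -> T'}, forall u, J u = tens1 psi (pr u).
  by exists (tens1 psi \o pr).
have [q qE] : exists q : {rmorphism Halg n -> T'}, forall u, q u = J (tens1 (R_Spm sg) u).
  by exists (J \o tens1 (R_Spm sg)).
have JS k : J k%:S = (psi k)%:S by rewrite JE; exact: (@tens1_scalar _ _ psi (BMWpm n sg)).
have J0 u : BMWpm_rel u -> J u = 0 by rewrite JE => /proj_gen h; rewrite /pr h rmorph0.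
have [f fS [fs fsV fe fC]] := tensor_F_to_BMW JS J0 qE.
pose IC (z : T) := z = tens1 phi (FC n).
have [p pE] : exists p : {rmorphism Falg n -> quot IC}, forall u,
  p u = proj IC (tens1 phi u).
  by exists (proj IC \o tens1 phi).
have pS k : p k%:S = (phi k)%:S.
  by rewrite pE; exact: (congr1 (proj IC) (@tens1_scalar _ _ phi (Falg n) k)).
have pC : p (FC n) = 0 by rewrite pE; exact: proj_gen.
have [g gS gs] := BMW_to_tensor_F pS pC.
have fs' i : f (tens1 phi (Fs i)) = tens1 psi (BMWpm_s sg i)
  by exact (etrans (fs i) (etrans (qE _) (JE _))).
(* It suffices to compare on the s_i. An element of the kernel of f then projects to 0, so it lies
   in the ideal of C, which is a span by [ideal_C]. *)
have gf z : g (f z) = proj IC z.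
  apply: (@tensor_F_ind n L phi (fun z => g (f z) = proj IC z) hn) =>
    [l|i|u v hu hv|u v hu hv].
  - by rewrite fS gS.
  - exact (etrans (congr1 g (fs' i)) (etrans (gs i) (pE _))).
  - by rewrite 3!rmorphD hu hv.
  - by rewrite 3!rmorphM hu hv.
exists f; split=> // [|i|z].
- split; first exact: rmorph_alg_morphism.
  apply: tensor_BMW_ind => [l|i|i|_ _ [u <-] [v <-]|_ _ [u <-] [v <-]].
  + by exists l%:S; exact: fS.
  + by exists (tens1 phi (Fs i)); exact: fs'.
  + by exists (tens1 phi (FsV i)); exact (etrans (fsV i) (etrans (qE _) (JE _))).
  + by exists (u + v); rewrite rmorphD.
  + by exists (u * v); rewrite rmorphM.
- exact (etrans (fe i) (JE _)).
split=> [fz|[k ->]]; last by rewrite rmorphM fC mulr0.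
apply: ideal_C => //; have := gf z; rewrite fz rmorph0 => /esym.
by rewrite -(rmorph0 (proj IC)) => /proj_eq; rewrite subr0.
Qed.

End TensorHecke.

Lemma Falg_BMW_kernel (n : nat) (e : bool) : (3 <= n)%N ->
  exists f : tensor (A_Sddpm e) (Falg n) -> tensor (Spm_Sddpm e) (BMWpm n e),
  [/\ alg_morphism f /\ surjective f,
      forall i : 'I_n.-1,
        f (tens1 (A_Sddpm e) (Fs i)) = tens1 (Spm_Sddpm e) (BMWpm_s e i),
      forall i : 'I_n.-1,
        f (tens1 (A_Sddpm e) (Fe i)) = tens1 (Spm_Sddpm e) (BMWpm_e e i),
      f (tens1 (A_Sddpm e) (FC n)) = 0
    & forall z, f z = 0 <->
        exists k : ringSddpm e, z = k%:S * tens1 (A_Sddpm e) (FC n)].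
Proof.
apply: tensor_F_BMW.
- by rewrite -Sddpm_a -A_Sdd_a.
- by rewrite Spm_Sddpm_R Sddpm_a.
- by rewrite Spm_Sddpm_R /= A_Sdd_x.
- by rewrite Spm_Sddpm_R R_Sdd_y rmorph1.
- by rewrite Spm_Sddpm_S /= A_Sdd_xV.
Qed.

(** * The filtration of [F_n] and its bimodule spanning property *)

Section Filtration.
Variable n : nat.
Local Notation F := (Falg n).
Implicit Types (i j : 'I_n.-1) (k : nat) (u v w z : F).

(* The image of F_(k+1) in F_n. *)
Inductive gen_by k : F -> Prop :=
| gen_scalar (c : ringA) : gen_by k c%:S
| gen_s i : (i < k)%N -> gen_by k (Fs i)
| gen_D u v : gen_by k u -> gen_by k v -> gen_by k (u + v)
| gen_M u v : gen_by k u -> gen_by k v -> gen_by k (u * v).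

Lemma gen_1 k : gen_by k 1.
Proof. by rewrite -(rmorph1 (@Defs.scalar ringA F)); exact: gen_scalar. Qed.

Lemma gen_Z k c u : gen_by k u -> gen_by k (c%:S * u).
Proof. by apply: gen_M; exact: gen_scalar. Qed.

Lemma opp_scalar (B : pzAlgType ringA) (u : B) : - u = (-1)%:S * u.
Proof. by rewrite rmorphN rmorph1 mulN1r. Qed.

Lemma gen_B k u v : gen_by k u -> gen_by k v -> gen_by k (u - v).
Proof. by move=> hu hv; rewrite [- v]opp_scalar; apply: gen_D => //; apply: gen_Z. Qed.

Lemma gen_sV k i : (i < k)%N -> gen_by k (FsV i).
Proof.
move=> /gen_s hi; rewrite FsVE expr2 mulrDl; apply: gen_Z; apply: gen_D.
  by apply: gen_B; [exact: gen_M|apply: gen_D; exact: gen_Z].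
by apply: gen_D (gen_1 k) (gen_Z _ (gen_scalar _ _)).
Qed.

Lemma gen_e k i : (i < k)%N -> gen_by k (Fe i).
Proof.
move=> hi; rewrite FeE; apply: gen_Z; apply: gen_B (gen_1 k); apply: gen_Z.
by apply: gen_D; [exact: gen_sV|exact: gen_s].
Qed.

Lemma gen_mono k l : (k <= l)%N -> forall u, gen_by k u -> gen_by l u.
Proof.
move=> kl u; elim=> [c|i ik|{}u v _ hu _ hv|{}u v _ hu _ hv].
- exact: gen_scalar.
- by apply: gen_s; apply: leq_trans kl.
- exact: gen_D.
- exact: gen_M.
Qed.

Lemma gen_comm k i u : (k < i)%N -> gen_by k u -> Fs i * u = u * Fs i.
Proof.
move=> ki; elim=> [c|j jk|{}u v _ hu _ hv|{}u v _ hu _ hv].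
- by rewrite scalarC.
- by rewrite [RHS]Fs_far // (leq_ltn_trans jk).
- by rewrite mulrDr hu hv mulrDl.
- by rewrite mulrA hu -mulrA hv mulrA.
Qed.

Lemma gen_commV k i u : (k < i)%N -> gen_by k u -> FsV i * u = u * FsV i.
Proof. by move=> ki /(gen_comm ki); apply: comm_invl (FsFsV i) (FsVFs i). Qed.

Lemma gen0 u : gen_by 0 u -> exists c : ringA, u = c%:S.
Proof.
elim=> [c|//|{}u v _ [c ->] _ [c' ->]|{}u v _ [c ->] _ [c' ->]].
- by exists c.
- by exists (c + c'); rewrite rmorphD.
- by exists (c * c'); rewrite rmorphM.
Qed.

Variant syllable i : F -> Prop :=
| syl_1 : syllable i 1
| syl_s : syllable i (Fs i)
| syl_sV : syllable i (FsV i).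

(** With generators numbered from 0, this is the bimodule over the image of F_(i+1) spanned by 1,
    s_i and s_i^-1. By [gen_bispan] it contains the image of F_(i+2). *)
Inductive bispan i : F -> Prop :=
| bispan_in u w v : gen_by i u -> syllable i w -> gen_by i v -> bispan i (u * w * v)
| bispan_D z z' : bispan i z -> bispan i z' -> bispan i (z + z').

Lemma bispan_Ml i u z : gen_by i u -> bispan i z -> bispan i (u * z).
Proof.
move=> hu; elim=> [u' w v hu' hw hv|z1 z2 _ h1 _ h2].
  by rewrite !mulrA; apply: bispan_in => //; apply: gen_M.
by rewrite mulrDr; apply: bispan_D.
Qed.

Lemma bispan_Mr i u z : gen_by i u -> bispan i z -> bispan i (z * u).
Proof.
move=> hu; elim=> [u' w v hu' hw hv|z1 z2 _ h1 _ h2].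
  by rewrite -[_ * v * u]mulrA; apply: bispan_in => //; apply: gen_M.
by rewrite mulrDl; apply: bispan_D.
Qed.

Lemma bispan_syl i w : syllable i w -> bispan i w.
Proof. by move=> hw; rewrite -[w]mulr1 -[w]mul1r; apply: bispan_in => //; exact: gen_1. Qed.

Lemma bispan_Z i c z : bispan i z -> bispan i (c%:S * z).
Proof. by apply: bispan_Ml; exact: gen_scalar. Qed.

Lemma bispan_B i z z' : bispan i z -> bispan i z' -> bispan i (z - z').
Proof. by move=> h h'; rewrite [- z']opp_scalar; apply: bispan_D => //;
  apply: bispan_Z. Qed.

Lemma bispan_e i : bispan i (Fe i).
Proof.
rewrite FeE; apply: bispan_Z; apply: bispan_B; last by apply/bispan_syl/syl_1.
by apply: bispan_Z; apply: bispan_D; apply: bispan_syl; constructor.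
Qed.

Lemma bispan_ss i : bispan i (Fs i * Fs i).
Proof.
have se : Fs i * cup aA xVA (Fs i) (FsV i) = aA%:S * cup aA xVA (Fs i) (FsV i).
  by rewrite -Fe_cup; exact: Fse.
rewrite (sqrE aA2 xxVA (FsFsV i) (FsVFs i) se) -Fe_cup.
apply: bispan_D; last by apply: bispan_Z; exact: bispan_e.
by apply: bispan_B; [apply: bispan_Z|]; apply: bispan_syl; constructor.
Qed.

Lemma bispan_s_syl i w : syllable i w -> bispan i (Fs i * w).
Proof.
case=> [||]; first by rewrite mulr1; apply/bispan_syl/syl_s.
- exact: bispan_ss.
- by rewrite FsFsV; apply/bispan_syl/syl_1.
Qed.

(** Braid relations leave a single letter s_i between letters s_j, except in s_i s_j^-1 s_i. That
    word is handled by [tsVtE], whose terms in e_i and s_i^2 are in the span. *)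
Lemma bispan_s_syl2 i j w' w : j.+1 = i :> nat -> syllable j w' -> syllable i w ->
  bispan i (Fs i * w' * w).
Proof.
move=> ji; have ij : adjacent j i by left.
have hj : gen_by i (Fs j) by apply: gen_s; rewrite -ji.
have hjV : gen_by i (FsV j) by apply: gen_sV; rewrite -ji.
have bi : bispan i (Fs i) by apply/bispan_syl/syl_s.
have biV : bispan i (FsV i) by apply/bispan_syl/syl_sV.
have br := Fs_artin ji.
have mid u v z : gen_by i u -> gen_by i v -> bispan i z -> bispan i (u * z * v).
  by move=> hu hv hz; apply: bispan_Mr => //; apply: bispan_Ml.
case=> [||] hw; first by rewrite mulr1; apply: bispan_s_syl.
- case: hw => [||]; first by rewrite mulr1; apply: bispan_Mr.
  + by rewrite -br; apply: mid.
  + rewrite (artin_sV (FsVFs j) (FsFsV i) br); exact: mid.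
- case: hw => [||]; first by rewrite mulr1; apply: bispan_Mr.
  + rewrite (tsVtE aA2 xxVA (Fs_pair ij)) -Fe_cup.
    apply: bispan_B; last exact: mid.
    apply: bispan_D; last by apply: bispan_Z; exact: bispan_ss.
    by apply: bispan_Z; apply: mid => //; exact: bispan_e.
  + rewrite (artin_sVV (FsFsV j) (FsVFs j) (FsFsV i) (FsVFs i) br).
    exact: mid.
Qed.

Lemma syllable_comm k i u w : (k < i)%N -> gen_by k u -> syllable i w -> w * u = u * w.
Proof.
move=> ki hu; case=> [||]; first by rewrite mulr1 mul1r.
- exact: gen_comm hu.
- exact: gen_commV hu.
Qed.

(** The span contains 1 and is stable under left multiplication by the generators below s_i.
    Hypothesis h supplies stability under s_i itself. *)
Lemma bispan_sM k i z : i = k :> nat ->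
    (forall u w, gen_by k u -> syllable i w -> bispan i (Fs i * u * w)) ->
  gen_by k.+1 z -> bispan i z.
Proof.
move=> ik h hz; rewrite -[z]mulr1; have : bispan i 1 by apply/bispan_syl/syl_1.
(* Generalising the factor 1 to any y in the span makes the induction on z go through products. *)
move: (1 : F) => y; elim: hz y => [c|j jk|u v _ hu _ hv|u v _ hu _ hv] y hy.
- exact: bispan_Z.
- have [jlt|jge] := ltnP j k; first by apply: bispan_Ml => //; apply: gen_s; rewrite ik.
  have -> : j = i by apply/val_inj/eqP; rewrite /= ik eqn_leq jge -ltnS jk.
  elim: hy => [u w v hu hw hv|y1 y2 _ h1 _ h2]; last by rewrite mulrDr; apply: bispan_D.
  by rewrite !mulrA; apply: bispan_Mr => //; apply: h => //; rewrite -ik.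
- by rewrite mulrDl; apply: bispan_D; [apply: hu|apply: hv].
- by rewrite -mulrA; apply/hu/hv.
Qed.

(** By induction the element u between s_i and w is a sum of terms u' w' v', with w' a syllable in
    s_(i-1). Since u' commutes with s_i and v' with w, only s_i w' w is left to treat. *)
Lemma gen_bispan k i z : i = k :> nat -> gen_by k.+1 z -> bispan i z.
Proof.
elim: k i z => [|k IH] i z ik; apply: bispan_sM => // u w hu hw.
  by have [c ->] := gen0 hu; rewrite -scalarC -mulrA; apply/bispan_Z/bispan_s_syl.
have kn : (k < n.-1)%N by rewrite (ltn_trans _ (ltn_ord i)) // ik.
pose j := Ordinal kn; have ji : j.+1 = i by rewrite ik.
have jlti : (j < i)%N by rewrite -ji.
elim: (IH j u erefl hu) => [u' w' v' hu' hw' hv'|y y' _ h _ h'].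
  have -> : Fs i * (u' * w' * v') * w = u' * (Fs i * w' * w) * v'.
    rewrite !mulrA (gen_comm jlti hu') -!mulrA; congr (_ * (_ * (_ * _))).
    exact/esym/(syllable_comm jlti hv' hw).
  have sub := gen_mono (ltnW jlti).
  by apply: bispan_Mr; [exact: sub|apply: bispan_Ml;
    [exact: sub|exact: (bispan_s_syl2 ji hw' hw)]].
by rewrite mulrDr mulrDl; apply: bispan_D.
Qed.

(** * Traces on [F_n] *)

Section Trace.
Variables (M : lmodType ringA) (d : F -> M).
Hypothesis d_linear : mod_linear d.
Hypothesis d_trace : forall u v, d (u * v) = d (v * u).

Lemma traceD u v : d (u + v) = d u + d v.
Proof.
have d0 : d 0 = 0 by have := d_linear.1 0 0; rewrite !subrr.
by rewrite -{1}[v]opprK d_linear.1 -[- v]sub0r d_linear.1 d0 sub0r opprK.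
Qed.

Lemma traceZ c u : d (c%:S * u) = c *: d u.
Proof. exact: d_linear.2. Qed.

(** By the trace property this says that d vanishes on all the terms of [bispan i] whose middle
    syllable is not 1. *)
Definition kills_syl i := forall w, gen_by i w -> d (w * Fs i) = 0 /\ d (w * FsV i) = 0.

(* For w commuting with t = s_j, conjugation by t turns w s_i into
   w t^-1 s_i t = w s_i t s_i^-1. *)
Lemma kills_syl_pred i j : i.+1 = j :> nat -> kills_syl j -> kills_syl i.
Proof.
move=> ij hj w hw; have ilt : (i < j)%N by rewrite -ij.
have sub := gen_mono (ltnW ilt).
have hs : gen_by j (Fs i) by exact: gen_s.
have hsV : gen_by j (FsV i) by exact: gen_sV.
have conj u : d (w * u) = d (w * (FsV j * u * Fs j)).
  rewrite !mulrA -(gen_commV ilt hw) -!mulrA [RHS]d_trace -!mulrA.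
  by rewrite FsFsV mulr1.
have gw u : gen_by j u -> forall v, gen_by j v -> gen_by j (u * w * v).
  by move=> hu v hv; apply: gen_M hv; apply: gen_M hu (sub _ hw).
have cyc u v : d (w * (u * Fs j * v)) = d (v * w * u * Fs j).
  by rewrite mulrA d_trace !mulrA.
have cycV u v : d (w * (u * FsV j * v)) = d (v * w * u * FsV j).
  by rewrite mulrA d_trace !mulrA.
have br : Fs j * Fs i * Fs j = Fs i * Fs j * Fs i by rewrite (Fs_artin ij).
split; rewrite conj.
  rewrite -(artin_sV (FsVFs j) (FsFsV i) br) cyc.
  exact (hj _ (gw _ hsV _ hs)).1.
rewrite -(artin_sVV (FsFsV j) (FsVFs j) (FsFsV i) (FsVFs i) br) cycV.
exact (hj _ (gw _ hsV _ hs)).2.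
Qed.

Lemma kills_syl_all j : j.+1 = n.-1 -> kills_syl j -> forall i, kills_syl i.
Proof.
move=> jn hj i; have [m] := ubnP (j - i); elim: m i => // m IH i.
have : (i <= j)%N by rewrite -ltnS jn.
rewrite leq_eqVlt => /orP[/eqP/val_inj -> //|ij] hm.
have i1 : (i.+1 < n.-1)%N by rewrite (leq_ltn_trans ij) // -jn.
apply: (@kills_syl_pred i (Ordinal i1)) => //; apply: IH.
by rewrite /= -ltnS subnSK.
Qed.

(** Descend along the filtration: in a term x w y of the span, cyclicity gives d (y x w). This is
    killed if w is s_i or its inverse, and lies one level lower if w = 1. Level 0 consists of
    scalars. *)
Lemma trace_eq0 z : (3 <= n)%N -> d 1 = 0 -> (forall i, kills_syl i) -> d z = 0.
Proof.
move=> hn d1 hk.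
have kill k u : (k <= n.-1)%N -> gen_by k u -> d u = 0.
  elim: k u => [|k IH] u kn hu.
    by have [c ->] := gen0 hu; rewrite -[c%:S]mulr1 traceZ d1 scaler0.
  elim: (@gen_bispan k (Ordinal kn) u erefl hu) => [x w y hx hw hy|y y' _ h _ h'].
    rewrite d_trace mulrA; have hyx : gen_by k (y * x) by exact: gen_M.
    case: hw => [||]; [|exact: (hk (Ordinal kn) _ hyx).1|exact: (hk (Ordinal kn) _ hyx).2].
    by rewrite mulr1; apply: IH => //; apply: ltnW.
  by rewrite traceD h h' addr0.
apply: (kill n.-1) => //.
apply: (@Falg_ind n (gen_by n.-1) hn) => [c|i|u v hu hv|u v hu hv].
- exact: gen_scalar.
- exact: gen_s.
- exact: gen_D.
- exact: gen_M.
Qed.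

Lemma trace1_eq0 : (3 <= n)%N -> (forall i, kills_syl i) -> d (FC n) = 0 -> d 1 = 0.
Proof.
move=> hn hk dC; have h1 : (1 < n.-1)%N by rewrite ltn_predRL.
pose i := Ordinal (ltnW h1); pose j := Ordinal h1.
have ij : adjacent i j by left.
have gi : gen_by j (Fe i) by apply: gen_e.
have de : d (Fe i) = 0.
  (* By cyclicity d (e_i s_j e_i) = d (e_i^2 s_j), where e_i^2 involves only generators below
     s_j. *)
  have := congr1 d (Fese ij); rewrite d_trace mulrA traceD dC addr0 => <-.
  exact (hk j _ (gen_M gi gi)).1.
have : d (aA%:S * Fe i) = 0 by rewrite traceZ de scaler0.
(* Here a e_i = (s_i^-1 + s_i) / x - 1, so that d (a e_i) = - d 1. *)
rewrite FeE scalar_mulA aA2 rmorph1 mul1r d_linear.1 traceZ traceD.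
have g1 : gen_by i 1 by exact: gen_1.
have := hk i _ g1; rewrite !mul1r => -[-> ->].
by rewrite addr0 scaler0 sub0r => /eqP; rewrite oppr_eq0 => /eqP.
Qed.

End Trace.
End Filtration.

(** * Markov traces and their uniqueness *)

Lemma braidalg_incl_hom (K : comPzRingType) n :
  exists2 f : {rmorphism braidalg K n -> braidalg K n.+1}, scalar_morph f &
  [/\ f =1 @braidalg_incl K n,
      forall i, f (bgen K i) = bgen K (widen_ord (leq_pred n) i : 'I_n.+1.-1)
    & forall i, f (bgenV K i) = bgenV K (widen_ord (leq_pred n) i : 'I_n.+1.-1)].
Proof.
have [||f fS [fE fg]] := @groupalg_hom K (braid n) (braidalg K n.+1)
  (fun x : braid n => gelt (braid_incl x)).
- by rewrite -[1%g]/(bclass [::]) braid_incl_class; exact: gelt1.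
- move=> x y; have [[u <-] [v <-]] := (bclass_surj x, bclass_surj y).
  by rewrite (bclassM u v) !braid_incl_class -geltM (bclassM (bwiden u)) /bwiden map_cat.
exists f => //; split=> // i.
  by rewrite fg braid_incl_class.
by rewrite fg artinV braid_incl_class /bgenV artinV.
Qed.

Lemma F_of_braid_surj n (z : Falg n) : (3 <= n)%N -> exists u, F_of_braid u = z.
Proof.
move=> hn; apply: (@Falg_ind n (fun z => exists u, F_of_braid u = z) hn).
- by move=> k; exists k%:S; exact: F_of_braidS.
- by move=> i; exists (bgen ringA i); exact: F_of_bgen.
- by move=> _ _ [u <-] [v <-]; exists (u + v); rewrite rmorphD.
- by move=> _ _ [u <-] [v <-]; exists (u * v); rewrite rmorphM.
Qed.

(** B_m has m - 1 generators, whence the bound. With [incl_gen_by], this identifies the image of B_m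
    with a level of the filtration. *)
Lemma gen_by_incl m (z : Falg m.+1) : gen_by m.-1 z ->
  exists u : braidalg ringA m, F_of_braid (braidalg_incl u) = z.
Proof.
have [f fS [fE fs fsV]] := braidalg_incl_hom ringA m.
elim=> [c|i im|u v _ [x <-] _ [y <-]|u v _ [x <-] _ [y <-]].
- by exists c%:S; rewrite -fE fS F_of_braidS.
- exists (bgen ringA (Ordinal im)); rewrite -fE fs F_of_bgen.
  by congr Fs; apply: val_inj.
- by exists (x + y); rewrite -!fE !rmorphD.
- by exists (x * y); rewrite -!fE !rmorphM.
Qed.

Lemma incl_gen_by m (u : braidalg ringA m) :
  gen_by m.-1 (F_of_braid (braidalg_incl u)).
Proof.
have [f fS [fE fs fsV]] := braidalg_incl_hom ringA m; rewrite -fE.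
elim/braidalg_ind: u => [k|u v hu hv|u v hu hv|i|i].
- by rewrite fS F_of_braidS; exact: gen_scalar.
- by rewrite !rmorphD; exact: gen_D.
- by rewrite !rmorphM; exact: gen_M.
- by rewrite fs F_of_bgen; apply: gen_s; exact (ltn_ord i).
- by rewrite fsV F_of_bgenV; apply: gen_sV; exact (ltn_ord i).
Qed.

Section MarkovUniqueness.
Variables (M : lmodType ringA) (d : forall m : nat, braidalg ringA m -> M).
Hypotheses (hd : markov_trace d) (hF : factors_through_F d).

Lemma F_trace m : (3 <= m)%N -> exists d' : Falg m -> M,
  [/\ mod_linear d', forall u v, d' (u * v) = d' (v * u)
    & forall u, d u = d' (F_of_braid u)].
Proof.
move=> hm; have [d' d'l d'E] := hF hm; exists d'; split=> // u v.
have [x <-] := F_of_braid_surj u hm; have [y <-] := F_of_braid_surj v hm.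
rewrite -!rmorphM -!d'E; case: m hm {d' d'l d'E u v} x y => // m _ x y.
by case: hd => _ ->.
Qed.

(** The Markov property removes the last generator and leaves a value of d on B_(m+1), which is
    zero. *)
Lemma kills_syl_top m (d' : Falg m.+2 -> M) :
    (forall u, d u = d' (F_of_braid u)) -> (forall u : braidalg ringA m.+1, d u = 0) ->
  kills_syl d' (ord_max : 'I_m.+2.-1).
Proof.
case: hd => _ _ dp dm d'E d0 w hw.
have [u <-] := @gen_by_incl m.+1 w hw.
rewrite -F_of_bgen -F_of_bgenV -!rmorphM -!d'E.
by rewrite dp dm d0.
Qed.

Lemma trace_step m : (2 <= m)%N -> (forall u : braidalg ringA m.+1, d u = 0) ->
  forall u : braidalg ringA m.+2, d u = 0.
Proof.
move=> hm d0 u; have h3 : (3 <= m.+2)%N by rewrite !ltnS ltnW.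
have [d' [d'l d't d'E]] := F_trace h3.
have top := kills_syl_top d'E d0.
have all := kills_syl_all d't (erefl : (ord_max : 'I_m.+2.-1).+1 = m.+2.-1) top.
rewrite d'E; apply: trace_eq0 => //; apply: trace1_eq0 => //.
(* As m >= 2, two adjacent generators, and with them C, lie below the last generator. *)
have gC : gen_by m (FC m.+2).
  have h1 : (1 < m.+2.-1)%N by rewrite ltnS ltnW.
  pose i := Ordinal (ltnW h1); pose j := Ordinal h1.
  have ge : gen_by m (Fe i) by apply: gen_e; rewrite /= ltnW.
  have gs : gen_by m (Fs j) by apply: gen_s.
  have ij : adjacent i j by left.
  rewrite -[FC _](addKr (Fe i)) -(Fese ij) addrC.
  by apply: gen_B => //; apply: gen_M => //; apply: gen_M.
(* C absorbs the last generator up to a, and a^2 = 1; in this form [top] kills it. *)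
have -> : FC m.+2 = aA%:S * FC m.+2 * Fs (ord_max : 'I_m.+2.-1).
  by rewrite -mulrA FCs scalar_mulA aA2 rmorph1 mul1r.
by apply: (top _ _).1; apply: gen_Z.
Qed.

Hypotheses (d31 : d (1 : braidalg ringA 3) = 0).
Hypothesis d3s : d (bgen ringA (ord0 : 'I_3.-1)) = 0.
Hypothesis d3ss : d (bgen ringA (ord0 : 'I_3.-1) * bgen ringA (ord_max : 'I_3.-1)) = 0.

Lemma braidalg_incl1 m : braidalg_incl (1 : braidalg ringA m) = 1.
Proof. by have [f _ [fE _ _]] := braidalg_incl_hom ringA m; rewrite -fE rmorph1. Qed.

Lemma braidalg_incl_gen m (i : 'I_m.-1) :
  braidalg_incl (bgen ringA i) = bgen ringA (widen_ord (leq_pred m) i : 'I_m.+1.-1).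
Proof. by have [f _ [fE fs _]] := braidalg_incl_hom ringA m; rewrite -fE fs. Qed.

(** The Markov property yields in turn d (s_1) = d (s_1 s_2) = 0 on B_2, d (1) = d (s_1) = 0 on B_1
    and d (s_1^-1) = d (1) = 0 on B_2. On B_2 one has d (1) = d (s_2), a value on B_3. The
    factorization starts at [F_3], so d (u) is read there as d (u s_2), with u in the span of 1, s_1
    and s_1^-1. *)
Lemma trace2_vanishes (u : braidalg ringA 2) : d u = 0.
Proof.
case: hd => dl dt dp dm.
have [//|d' [d'l d't d'E]] := @F_trace 3.
pose s0 := Fs (ord0 : 'I_3.-1); pose s1 := Fs (ord_max : 'I_3.-1).
have w0 : widen_ord (leq_pred 2) (ord0 : 'I_2.-1) = ord0 :> 'I_3.-1 by apply: val_inj.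
have m0 : (ord_max : 'I_2.-1) = ord0 by apply: val_inj.
have d2s : d (bgen ringA (ord0 : 'I_2.-1)) = 0.
  by rewrite -dp braidalg_incl_gen w0.
have d11 : d (1 : braidalg ringA 1) = 0.
  by rewrite -dp braidalg_incl1 mul1r m0.
have d2sV : d (bgenV ringA (ord0 : 'I_2.-1)) = 0.
  by rewrite -[RHS]d11 -[RHS]dm braidalg_incl1 mul1r m0.
have d21 : d (1 : braidalg ringA 2) = 0.
  rewrite -dp braidalg_incl1 mul1r d'E F_of_bgen.
  have br : s0 * s1 * s0 = s1 * s0 * s1 by apply: Fs_artin.
  (* Writes s_2 as the conjugate of s_1 by s_1 s_2, so that both have the same trace. *)
  have -> : Fs (ord_max : 'I_2.+1.-1) =
      s0 * s1 * (s0 * (FsV (ord_max : 'I_3.-1) * FsV (ord0 : 'I_3.-1))).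
    by rewrite !mulrA br -[_ * s1 * FsV _]mulrA FsFsV mulr1 -mulrA FsFsV mulr1.
  rewrite d't -!mulrA [FsV _ * (s0 * _)]mulrA FsVFs mul1r FsVFs mulr1.
  by rewrite /s0 -F_of_bgen -d'E.
have FM (v : braidalg ringA 2) :
  F_of_braid (braidalg_incl v * bgen ringA (ord_max : 'I_2.+1.-1)) =
    F_of_braid (braidalg_incl v) * Fs (ord_max : 'I_2.+1.-1).
  exact (etrans (rmorphM (@F_of_braid 3) _ _) (congr1 _ (F_of_bgen (n := 3) _))).
rewrite -dp d'E FM.
elim: (@gen_bispan 3 0 ord0 _ erefl (incl_gen_by u)) => [x w y hx hw hy|y y' _ h _ h'].
  have [c ->] := gen0 hx; have [c' ->] := gen0 hy.
  rewrite -!mulrA (traceZ d'l) mulr_scalar (traceZ d'l).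
  suff -> : d' (w * Fs (ord_max : 'I_2.+1.-1)) = 0 by rewrite !scaler0.
  have mk (v : braidalg ringA 2) : d v = 0 ->
      d' (F_of_braid (braidalg_incl v) * Fs (ord_max : 'I_2.+1.-1)) = 0.
    by move=> <-; rewrite -[RHS]dp d'E FM.
  have [f _ [fE fs fsV]] := braidalg_incl_hom ringA 2.
  case: hw.
  - by have := mk _ d21; rewrite braidalg_incl1 rmorph1.
  - by have := mk _ d2s; rewrite -fE fs w0 F_of_bgen.
  - by have := mk _ d2sV; rewrite -fE fsV w0 F_of_bgenV.
by rewrite mulrDl (traceD d'l) h h' addr0.
Qed.

(** B_1 follows from B_2 by the Markov property, and [trace_step] applies from B_4 on. On B_3 the
    vanishing of d (1) is the hypothesis [d31]. *)
Lemma trace_vanishes m (u : braidalg ringA m) : (0 < m)%N -> d u = 0.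
Proof.
have d3 (v : braidalg ringA 3) : d v = 0.
  have [//|d' [d'l d't d'E]] := @F_trace 3; rewrite d'E; apply: trace_eq0 => //.
    by rewrite -(rmorph1 (@F_of_braid 3)) -d'E.
  exact: (kills_syl_all d't (erefl : (ord_max : 'I_3.-1).+1 = 3.-1)
    (kills_syl_top d'E trace2_vanishes)).
case: m u => [|[|[|m]]] u // _; [|exact: trace2_vanishes|].
  by case: hd => _ _ dp _; rewrite -dp; exact: trace2_vanishes.
elim: m u => [|m IH] u; first exact: d3.
exact: trace_step.
Qed.

End MarkovUniqueness.

Lemma markov_trace_sub (M : lmodType ringA)
    (t t' : forall m : nat, braidalg ringA m -> M) :
  markov_trace t -> markov_trace t' -> markov_trace (fun m u => t m u - t' m u).
Proof.
case=> l1 c1 p1 q1 [l2 c2 p2 q2]; split=> [m|m u v|m u|m u].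
- split=> [u v|k u]; first by rewrite (l1 m).1 (l2 m).1 !opprD opprK addrACA.
  by rewrite (l1 m).2 (l2 m).2 scalerBr.
- by rewrite c1 c2.
- by rewrite p1 p2.
- by rewrite q1 q2.
Qed.

Lemma factors_through_F_sub (M : lmodType ringA)
    (t t' : forall m : nat, braidalg ringA m -> M) :
  factors_through_F t -> factors_through_F t' ->
  factors_through_F (fun m u => t m u - t' m u).
Proof.
move=> h h' m hm; have [f [fB fZ] fE] := h m hm; have [g [gB gZ] gE] := h' m hm.
exists (fun z => f z - g z) => [|u]; last by rewrite fE gE.
split=> [u v|k u]; first by rewrite fB gB !opprD opprK addrACA.
by rewrite fZ gZ scalerBr.
Qed.

Theorem proposition6p1 (n : nat) (hn : (3 <= n)%N) :
  [/\
    (* (1) *)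
    exists f : tensor R_Sdd (Halg n) -> tensor A_Sdd (Falg n),
      [/\ alg_morphism f, surjective f,
          forall i : 'I_n.-1, f (tens1 R_Sdd (Hs i)) = tens1 A_Sdd (Fs i)
        & exists2 g : tensor R_Sdd (BMWtalg n) -> tensor A_Sdd (Falg n),
            alg_morphism g &
            forall z, f z = g (tensor_map R_Sdd (proj (@BMWt_rel n)) z)],
    (* (2) *)
    forall e : bool,
      exists f : tensor (A_Sddpm e) (Falg n) -> tensor (Spm_Sddpm e) (BMWpm n e),
        [/\ alg_morphism f /\ surjective f,
            forall i : 'I_n.-1,
              f (tens1 (A_Sddpm e) (Fs i)) = tens1 (Spm_Sddpm e) (BMWpm_s e i),
            forall i : 'I_n.-1,
              f (tens1 (A_Sddpm e) (Fe i)) = tens1 (Spm_Sddpm e) (BMWpm_e e i),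
            f (tens1 (A_Sddpm e) (FC n)) = 0
          & forall z, f z = 0 <->
              exists k : ringSddpm e, z = k%:S * tens1 (A_Sddpm e) (FC n)],
    (* (3) *)
    (exists phi : braidalg ringA n -> braidalg ringA n,
      [/\ alg_morphism phi, bijective phi,
          forall i : 'I_n.-1, phi (bgen ringA i) = bgenV ringA i
        & exists psi : Falg n -> Falg n,
            [/\ alg_morphism psi, bijective psi
              & forall u, psi (F_of_braid u) = F_of_braid (phi u)]])
    /\
    (exists phi : braidalg ringA n -> braidalg ringA n,
      [/\ alg_antimorphism phi, bijective phi,
          forall i : 'I_n.-1, phi (bgen ringA i) = bgenV ringA i
        & exists psi : Falg n -> Falg n,
            [/\ alg_antimorphism psi, bijective psi
              & forall u, psi (F_of_braid u) = F_of_braid (phi u)]])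
  & (* (4) *)
    forall (M : lmodType ringA) (t t' : forall m : nat, braidalg ringA m -> M),
      markov_trace t -> factors_through_F t ->
      markov_trace t' -> factors_through_F t' ->
      t 3%N 1 = t' 3%N 1 ->
      t 3%N (bgen ringA (ord0 : 'I_3.-1)) = t' 3%N (bgen ringA (ord0 : 'I_3.-1)) ->
      t 3%N (bgen ringA (ord0 : 'I_3.-1) * bgen ringA (ord_max : 'I_3.-1)) =
        t' 3%N (bgen ringA (ord0 : 'I_3.-1) * bgen ringA (ord_max : 'I_3.-1)) ->
      forall m : nat, (0 < m)%N -> forall u : braidalg ringA m, t m u = t' m u].
Proof.
split; [exact: Falg_Hecke_quotient|by move=> e; exact: Falg_BMW_kernel| |].
  split; [exact: Falg_inverse_automorphism|exact: Falg_inverse_antiautomorphism].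
move=> M t t' ht Ft ht' Ft' e1 es ess m m0 u; apply/eqP; rewrite -subr_eq0; apply/eqP.
apply: (trace_vanishes (markov_trace_sub ht ht') (factors_through_F_sub Ft Ft')) => //.
- by rewrite e1 subrr.
- by rewrite es subrr.
- by rewrite ess subrr.
Qed.
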